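(* Let $K$ be a field, $S=K[x_1,\ldots,x_n]$ a standard graded polynomial ring, and let $e,d$ be integers with $2\leq e\leq d$. Let $I\subseteq S$ be a monomial ideal all of whose minimal monomial generators have degree between $e$ and $d$ (inclusive). Put $R=S/I$, $p=\operatorname{pd}_S R$, $t_i=t_i(R)$ and $\delta_i=di-t_i$ for $0\le i\le p$. If $t_a<ae$ for some integer $a$ with $2\leq a\leq p$, then $$\operatorname{reg} R\leq\max\left\{(d-1)(a-1),\ (d-1)p-\delta_a-\left\lfloor\frac{p-a}{2}\right\rfloor\right\}.$$ In particular, $$\operatorname{reg} R\leq\max\left\{(d-1)(a-1),\ (d-1)p-a(d-e)-1-\left\lfloor\frac{p-a}{2}\right\rfloor\right\}.$$
   Context: For a graded quotient $R=S/I$, let $\beta^S_{i,j}(R)=\dim_K \operatorname{Tor}^S_i(R,K)_j$ be its graded Betti numbers and $\operatorname{pd}_S R$ its projective dimension over $S$. For $0\leq i\leq \operatorname{pd}_S R$, the $i$-th maximal shift is $t_i(R)=\max\{j:\beta^S_{i,j}(R)\neq 0\}$ (with $t_0(R)=0$). The Castelnuovo–Mumford regularity is $\operatorname{reg} R=\max_{0\leq i\leq p}\{t_i(R)-i\}$, where $p=\operatorname{pd}_S R$. *)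

(* Defs.v *)
From HB Require Import structures.
From mathcomp Require Import all_boot all_order all_algebra.
From mathcomp.multinomials Require Import mpoly.

Set Implicit Arguments.
Unset Strict Implicit.
Unset Printing Implicit Defensive.

Import Order.TTheory GRing.Theory Num.Theory.

Local Open Scope ring_scope.

Section MonomialIdeals.

Variables (K : fieldType) (n : nat).
Implicit Types (I : {mpoly K[n]} -> Prop) (m : 'X_{1..n}).

Definition monomial_ideal I : Prop :=
  exists A : 'X_{1..n} -> Prop, forall f : {mpoly K[n]},
    I f <-> exists s : seq ({mpoly K[n]} * 'X_{1..n}),
              (forall c, c \in s -> A c.2) /\
              f = \sum_(c <- s) c.1 * 'X_[c.2].

(* On exponent vectors, [<=] of multinomials is divisibility of monomials. *)
Definition minimal_generator I m : Prop :=
  I 'X_[m] /\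
  (forall m', I 'X_[m'] -> (m' <= m)%MM -> m' = m).

End MonomialIdeals.

(* A graded free resolution  ... -> F_1 -> F_0 -> S/I -> 0  by free modules of
   finite rank, F_i = \bigoplus_k S(- gfr_shift i k). Elements of F_i are row
   vectors and maps act by right multiplication; the augmentation F_0 -> S/I is
   given by representatives in S of the images of the basis vectors, so that
   surjectivity and exactness at F_0 are expressed modulo I. Homogeneity says
   that every map has degree 0 once the shifts are taken into account. *)
Record graded_free_resolution (K : fieldType) (n : nat)
    (I : {mpoly K[n]} -> Prop) := GradedFreeResolution {
  gfr_rank : nat -> nat;
  gfr_shift : forall i, 'I_(gfr_rank i) -> nat;
  gfr_aug : 'cV[{mpoly K[n]}]_(gfr_rank 0);
  gfr_diff : forall i, 'M[{mpoly K[n]}]_(gfr_rank i.+1, gfr_rank i);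
  gfr_aug_homog : forall k m,
    m \in msupp (gfr_aug k 0) -> mdeg m = gfr_shift k;
  gfr_diff_homog : forall i k l m,
    m \in msupp (gfr_diff i k l) ->
    (mdeg m + gfr_shift l)%N = gfr_shift k;
  gfr_aug_surj : forall f : {mpoly K[n]},
    exists v : 'rV_(gfr_rank 0), I (f - (v *m gfr_aug) 0 0);
  gfr_exact0 : forall v : 'rV_(gfr_rank 0),
    I ((v *m gfr_aug) 0 0) <-> exists w, v = w *m gfr_diff 0;
  gfr_exactS : forall i (v : 'rV_(gfr_rank i.+1)),
    v *m gfr_diff i = 0 <-> exists w, v = w *m gfr_diff i.+1
}.

Section BettiNumbers.

Variables (K : fieldType) (n : nat) (I : {mpoly K[n]} -> Prop).
Implicit Type F : graded_free_resolution I.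

(* The differential of F (x)_S K, where K = S/(x_1, ..., x_n): tensoring keeps
   the constant coefficients of the entries. *)
Definition tensor_diff F i : 'M[K]_(gfr_rank F i.+1, gfr_rank F i) :=
  map_mx (mcoeff 0%MM) (gfr_diff F i).

(* The row space of this matrix is (F_i (x)_S K)_j. *)
Definition tensor_degree F i j : 'M[K]_(gfr_rank F i) :=
  diag_mx (\row_k (gfr_shift k == j)%:R).

Definition tensor_cycles F i j : 'M[K]_(gfr_rank F i) :=
  match i return 'M[K]_(gfr_rank F i) with
  | 0%N => tensor_degree F 0 j
  | i'.+1 => (tensor_degree F i'.+1 j :&: kermx (tensor_diff F i'))%MS
  end.

Definition tensor_boundaries F i j : 'M[K]_(gfr_rank F i.+1, gfr_rank F i) :=
  tensor_degree F i.+1 j *m tensor_diff F i.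

(* dim_K Tor_i^S(S/I, K)_j = dim_K H_i(F (x)_S K)_j *)
Definition graded_betti F i j : nat :=
  (\rank (tensor_cycles F i j) - \rank (tensor_boundaries F i j))%N.

(* Only the finitely many degrees of basis vectors of F_i have to be considered:
   see [graded_betti_shift] and [max_shift_ub] below. *)
Definition max_shift F i : nat :=
  \max_(k < gfr_rank F i | graded_betti F i (gfr_shift k) != 0%N) gfr_shift k.

Definition resolution_length_le F (l : nat) : Prop :=
  forall i, (l < i)%N -> gfr_rank F i = 0%N.

(* The index 0 term also serves as the base value of the maximum. *)
Definition regularity F (p : nat) : int :=
  \big[Num.max/(max_shift F 0)%:Z]_(i < p.+1) ((max_shift F i)%:Z - i%:Z).

Lemma graded_betti_shift F i j :
  graded_betti F i j != 0%N -> exists k : 'I_(gfr_rank F i), gfr_shift k = j.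
Proof.
move=> nz; case: (pickP (fun k : 'I_(gfr_rank F i) => gfr_shift k == j)).
  by move=> k /eqP <-; exists k.
move=> noj; case/negP: nz.
have D0 : tensor_degree F i j = 0.
  by apply/matrixP=> k l; rewrite !mxE noj mul0rn.
rewrite /graded_betti; suff -> : \rank (tensor_cycles F i j) = 0%N by [].
apply/eqP; rewrite -leqn0 -(mxrank0 K (gfr_rank F i) (gfr_rank F i)) -D0.
by apply: mxrankS; case: (i) => [|i'] /=; rewrite ?capmxSl.
Qed.

Lemma max_shift_ub F i j : graded_betti F i j != 0%N -> (j <= max_shift F i)%N.
Proof.
move=> nz; have [k kj] := graded_betti_shift nz; rewrite -kj in nz *.
exact: (@leq_bigmax_cond _ _ (fun k => gfr_shift k)).
Qed.

Lemma max_shift_attained F i j :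
  graded_betti F i j != 0%N -> graded_betti F i (max_shift F i) != 0%N.
Proof.
move=> nz; have [k kj] := graded_betti_shift nz; rewrite -kj in nz.
rewrite /max_shift (bigop.bigmax_eq_arg k) //.
by case: arg_maxnP.
Qed.

End BettiNumbers.

Definition projective_dimension (K : fieldType) (n : nat)
    (I : {mpoly K[n]} -> Prop) (p : nat) : Prop :=
  (exists F : graded_free_resolution I, resolution_length_le F p) /\
  (forall (F : graded_free_resolution I) (q : nat),
     resolution_length_le F q -> (p <= q)%N).

(* Main.v *)
Require Import Defs.
From HB Require Import structures.
From mathcomp Require Import all_boot all_order all_algebra.
From mathcomp.multinomials Require Import mpoly.
From mathcomp Require Import zify.
From Stdlib Require Import Classical ClassicalEpsilon.

(* Let L_V be the complex spanned by the sets of minimal generators with least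
   common multiple V: the part of multidegree V of K (x) (Taylor resolution), so
   beta_{i,j} <> 0 iff H_i(L_V) <> 0 for some V of degree j. For a generator m | V,
   the sets s with lcm(s, m) = V span an acyclic complex (add or remove m), having
   L_V as its top part. Hence H_{i+1}(L_V) <> 0 gives W with H_i(L_W) <> 0 and
   lcm(W, m) = V, so t_{i+1} <= t_i + d.

   For two generators m, m' | V, comparing the sets s with lcm(s, m) = V, those with
   lcm(s, m') = V and those with lcm(s, m, m') = V shows that H_{i+2}(L_V) <> 0 gives
   W with either H_{i+1}(L_W) <> 0 and lcm(W, m) = V = lcm(W, m'), or H_i(L_W) <> 0
   and lcm(W, m, m') = V. If m and m' are distinct and not coprime, then
   deg gcd(m, m') is positive and less than d, and deg V <= t_i + 2d - 1 in both cases.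
   If all generators dividing V are pairwise coprime, the product of any a of them
   contributes to beta_a, whence t_a >= ae. So t_a < ae forces
   delta_{i+2} >= delta_i + 1 for i >= a, which gives the bound. *)

Set Implicit Arguments.
Unset Strict Implicit.
Unset Printing Implicit Defensive.

Import Order.TTheory GRing.Theory Num.Theory.

Local Open Scope ring_scope.

(** * Relative acyclicity of sets of faces of a simplex *)

Section SignedSubsets.

Variables (R : comNzRingType) (N : nat).
Implicit Types (s t : {set 'I_N}) (x y : 'I_N) (f g : {set 'I_N} -> R).

(** The incidence number of the face [s] in [x |: s], meant for [x] outside [s]. *)
Definition inc_sign s x : R := (-1) ^+ #|[set y in s | (y < x)%N]|.

Lemma inc_signK s x : inc_sign s x * inc_sign s x = 1.
Proof. by rewrite /inc_sign -signr_odd; case: (odd _); rewrite ?mulrNN !mulr1. Qed.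

Lemma inc_signU1 s x y : x \notin s ->
  inc_sign (x |: s) y = (-1) ^+ (x < y)%N * inc_sign s y.
Proof.
move=> xs; rewrite /inc_sign -exprD; congr (_ ^+ _).
case: ltnP => [xy|yx].
  have -> : [set z in x |: s | (z < y)%N] = x |: [set z in s | (z < y)%N].
    by apply/setP=> z; rewrite !inE; case: eqP => [->|].
  by rewrite cardsU1 !inE (negbTE xs).
rewrite add0n; apply: eq_card => z; rewrite !inE.
by case: eqP => [->|] //=; rewrite ltnNge yx (negbTE xs).
Qed.

(** Exactly one of [x < y] and [y < x] holds, so exactly one of the two signs on the left
    changes. *)
Lemma inc_sign_swap s x y : x != y -> x \notin s -> y \notin s ->
  inc_sign (x |: s) y * inc_sign (y |: s) x = - (inc_sign s x * inc_sign s y).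
Proof.
move=> xy xs ys; rewrite !inc_signU1 // mulrACA -exprD -[RHS]mulN1r.
rewrite [inc_sign s y * _]mulrC; congr (_ * _).
by case: ltngtP (xy) => // /val_inj ->; rewrite eqxx.
Qed.

Lemma inc_sign_anticomm s x y : x != y -> x \notin s -> y \notin s ->
  inc_sign s x * inc_sign (x |: s) y + inc_sign s y * inc_sign (y |: s) x = 0.
Proof.
move=> xy xs ys; apply/eqP; rewrite addr_eq0; apply/eqP.
rewrite -[LHS]mulr1 -(inc_signK (y |: s) x) mulrA -[inc_sign s x * _ * _]mulrA.
by rewrite inc_sign_swap // mulrN mulrA inc_signK mul1r mulNr.
Qed.

(** A chain is given by its coefficients on faces. The empty set counts as a face, so this is the
    augmented simplicial boundary, graded by cardinality. *)
Definition bdry f s : R := \sum_(x | x \notin s) inc_sign s x * f (x |: s).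

Lemma bdryB f g s : bdry (fun t => f t - g t) s = bdry f s - bdry g s.
Proof. by rewrite /bdry -sumrB; apply: eq_bigr => x _; rewrite mulrBr. Qed.

Lemma bdry_bdry f s : bdry (bdry f) s = 0.
Proof.
have E x : x \notin s -> inc_sign s x * bdry f (x |: s) =
    \sum_(y | (y \notin s) && (x != y))
      inc_sign s x * inc_sign (x |: s) y * f (y |: (x |: s)).
  move=> xs; rewrite /bdry big_distrr /=; apply: eq_big => [y|y _].
    by rewrite !inE negb_or andbC eq_sym.
  by rewrite mulrA.
rewrite /bdry (eq_bigr _ E).
pose F x y := inc_sign s x * inc_sign (x |: s) y * f (y |: (x |: s)).
(* Splitting by the order of [x] and [y] and exchanging the sums in one half pairs the two orders of
   adding the same two vertices, whose signs cancel. *)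
rewrite (eq_bigr (fun x => \sum_(y | (y \notin s) && (x < y)%N) F x y +
                           \sum_(y | (y \notin s) && (y < x)%N) F x y)); last first.
  move=> x _; rewrite (bigID (fun y : 'I_N => (x < y)%N)) /=; congr (_ + _).
    apply: eq_bigl => y; case: (ltngtP x y) => [xy|xy|/val_inj ->].
    - by rewrite !andbT; case: eqP xy => [->|]; rewrite ?ltnn ?andbT.
    - by rewrite !andbF.
    - by rewrite !andbF.
  apply: eq_bigl => y; rewrite -leqNgt leq_eqVlt.
  case: (eqVneq x y) => [->|xy]; first by rewrite ltnn !andbF.
  by rewrite andbT; case: eqP => // /val_inj yx; rewrite yx eqxx in xy.
rewrite big_split /= [X in _ + X](exchange_big_dep (fun y => y \notin s)) /=;
  last by move=> x y _ /andP[].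
rewrite -big_split big1 //= => x xs.
rewrite [X in _ + X](eq_bigl (fun y => (y \notin s) && (x < y)%N)); last first.
  by move=> y; rewrite xs.
rewrite -big_split big1 //= => y /andP[ys xy].
have nxy : x != y by apply: contraTneq xy => ->; rewrite ltnn.
rewrite /F setUCA -mulrDl.
by rewrite inc_sign_anticomm // mul0r.
Qed.

End SignedSubsets.

(** * Long exact sequences for convex sets of faces *)

Section RelativeAcyclicity.

Variables (K : fieldType) (N : nat).
Implicit Types (r s t : {set 'I_N}) (U D W : {set {set 'I_N}}).
Implicit Types (f g : {set 'I_N} -> K).

Definition supported i U f := forall s, f s != 0 -> s \in U /\ #|s| = i.

(* [H_i = 0] for the complex spanned by [U], whose boundary drops the faces outside
   [U]; this is a complex when [U] is convex. *)
Definition acyc i U := forall f, supported i U f ->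
  {in U, forall s, bdry f s = 0} ->
  exists2 g, supported i.+1 U g & {in U, forall s, bdry g s = f s}.

Definition convex U := forall r s t, r \subset s -> s \subset t ->
  r \in U -> t \in U -> s \in U.

(** Then [D] spans a subcomplex of the complex of [U], and [U :\: D] spans the quotient. *)
Definition lower D U := D \subset U /\
  forall s t, s \subset t -> t \in D -> s \in U -> s \in D.

Definition res U f s := if s \in U then f s else 0.


Lemma supported_bdry i f U : supported i.+1 U f -> forall s, bdry f s != 0 -> #|s| = i.
Proof.
move=> fU s; apply: contra_neq_eq => si; rewrite /bdry big1 // => x xs.
case: (eqVneq (f (x |: s)) 0) => [->|/fU[_]]; first by rewrite mulr0.
by rewrite cardsU1 xs add1n => -[] E; rewrite E eqxx in si.
Qed.

(** By convexity a face lying between a face of [U] and a face in the support of [f] is in [U], so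
    truncating the inner boundary loses no term. *)
Lemma bdry_res_bdry i U f : convex U -> supported i U f ->
  {in U, forall s, bdry (res U (bdry f)) s = 0}.
Proof.
move=> cU fU s sU; rewrite -[RHS](bdry_bdry f s).
apply: eq_bigr => x xs; congr (_ * _); rewrite /res; case: ifPn => // xsU.
apply/esym; rewrite [LHS]big1 // => y ys.
case: (eqVneq (f (y |: (x |: s))) 0) => [->|/fU[yU _]]; first by rewrite mulr0.
by case/negP: xsU; apply: (cU s _ (y |: (x |: s))) => //; apply: subsetUr.
Qed.

(** Exactness of H_i(D) -> H_i(U) -> H_i(U/D) in the middle. *)
Lemma acyc_ext i U D : convex U -> lower D U ->
  acyc i D -> acyc i (U :\: D) -> acyc i U.
Proof.
move=> cU [DU lD] aD aW f fU f0.
have fW : supported i (U :\: D) (res (U :\: D) f).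
  move=> s; rewrite /res; case: ifP => [sW /fU[]|]; last by rewrite eqxx.
  by [].
case: (aW _ fW) => [s /[dup] sW /setDP[sU sD]|g gW gE].
  rewrite -[RHS](f0 s sU); apply: eq_bigr => x xs; congr (_ * _).
  rewrite /res; case: ifPn => //; rewrite in_setD negb_and negbK => /orP[xD|xU].
    by case/negP: sD; apply: (lD s (x |: s)) => //; apply: subsetUr.
  by apply/esym/eqP; apply: contraNT xU => /fU[].
have gU : supported i.+1 U g by move=> s /gW[/setDP[]].
(* Subtracting the boundary of a filling found in the quotient leaves a cycle supported on [D]. *)
pose f' := fun s => f s - res U (bdry g) s.
have f'D : supported i D f'.
  move=> s; rewrite /f' /res; case: ifPn => sU; last first.
    by rewrite subr0 => /fU[sU']; rewrite sU' in sU.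
  case: (boolP (s \in D)) => sD nz.
    split=> //; apply/eqP; apply: contraNT nz => si; rewrite subr_eq0; apply/eqP.
    transitivity (0 : K).
      by apply/eqP; apply: contraNT si => /fU[_ ->].
    by apply/esym/eqP; apply: contraNT si => /(supported_bdry gU) ->.
  have sW : s \in U :\: D by rewrite inE sD.
  by move: nz; rewrite gE // /res sW subrr eqxx.
case: (aD _ f'D) => [s sD|h hD hE].
  have sU := subsetP DU s sD.
  by rewrite /f' bdryB f0 // (bdry_res_bdry cU gU sU) subr0.
exists (fun s => g s + h s).
  move=> s; case: (eqVneq (g s) 0) => [->|/gU//].
  by rewrite add0r => /hD[sD ?]; split=> //; apply: (subsetP DU).
move=> s sU; rewrite /bdry; under eq_bigr do rewrite mulrDr.
rewrite big_split /= -/(bdry g s) -/(bdry h s).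
case: (boolP (s \in D)) => sD.
  by rewrite hE // /f' /res sU addrC subrK.
rewrite gE ?inE ?sD // /res inE sD sU /=.
rewrite [X in _ + X]big1 ?addr0 // => x xs.
case: (eqVneq (h (x |: s)) 0) => [->|/hD[xD _]]; first by rewrite mulr0.
by case/negP: sD; apply: (lD s (x |: s)) => //; apply: subsetUr.
Qed.

(** Exactness of H_{i+1}(U) -> H_{i+1}(U/D) -> H_i(D) in the middle. *)
Lemma acyc_quo i U D : convex U -> lower D U ->
  acyc i.+1 U -> acyc i D -> acyc i.+1 (U :\: D).
Proof.
move=> cU [DU lD] aU aD f fW f0.
have fU : supported i.+1 U f by move=> s /fW[/setDP[]].
(* The connecting map: the boundary in [U] of a relative cycle is a cycle of [D]. *)
pose f1 := res U (bdry f).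
have f1D : supported i D f1.
  move=> s; rewrite /f1 /res; case: ifP => [sU nz|]; last by rewrite eqxx.
  split; last exact: supported_bdry fU s nz.
  by apply: contraNT nz => sD; rewrite f0 ?inE ?sD.
case: (aD _ f1D) => [s sD|g gD gE].
  exact: bdry_res_bdry cU fU _ (subsetP DU s sD).
have gU : supported i.+1 U g.
  by move=> s /gD[sD ?]; split=> //; apply: (subsetP DU).
have g0 s : s \in U -> s \notin D -> bdry g s = 0.
  move=> sU sD; apply: big1 => x xs.
  case: (eqVneq (g (x |: s)) 0) => [->|/gD[xD _]]; first by rewrite mulr0.
  by case/negP: sD; apply: (lD s (x |: s)) => //; apply: subsetUr.
case: (aU (fun s => f s - g s)) => [s|s sU|h hU hE].
- by case: (eqVneq (f s) 0) => [->|/fU//]; rewrite sub0r oppr_eq0 => /gU.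
- rewrite bdryB; case: (boolP (s \in D)) => sD.
    by rewrite gE // /f1 /res sU subrr.
  by rewrite g0 // f0 ?inE ?sD // subrr.
exists (res (U :\: D) h).
  by move=> s; rewrite /res; case: ifP => [sW /hU[]|]; rewrite ?eqxx.
move=> s /[dup] sW /setDP[sU sD].
have -> : f s = f s - g s.
  suff -> : g s = 0 by rewrite subr0.
  by apply/eqP; apply: contraNT sD => /gD[].
rewrite -hE //; apply: eq_bigr => x xs; congr (_ * _); rewrite /res.
case: ifPn => //; rewrite in_setD negb_and negbK => /orP[xD|xU].
  by case/negP: sD; apply: (lD s (x |: s)) => //; apply: subsetUr.
by apply/esym/eqP; apply: contraNT xU => /hU[].
Qed.

(** Exactness of H_{i+1}(U/D) -> H_i(D) -> H_i(U) in the middle. *)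
Lemma acyc_sub i U D : convex U -> lower D U ->
  acyc i U -> acyc i.+1 (U :\: D) -> acyc i D.
Proof.
move=> cU [DU lD] aU aW f fD f0.
have fU : supported i U f.
  by move=> s /fD[sD ?]; split=> //; apply: (subsetP DU).
case: (aU _ fU) => [s sU|g gU gE].
  case: (boolP (s \in D)) => sD; first exact: f0.
  apply: big1 => x xs.
  case: (eqVneq (f (x |: s)) 0) => [->|/fD[xD _]]; first by rewrite mulr0.
  by case/negP: sD; apply: (lD s (x |: s)) => //; apply: subsetUr.
pose g1 := res (U :\: D) g.
have g1W : supported i.+1 (U :\: D) g1.
  by move=> s; rewrite /g1 /res; case: ifP => [sW /gU[]|]; rewrite ?eqxx.
case: (aW _ g1W) => [s /[dup] sW /setDP[sU sD]|h hW hE].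
  transitivity (bdry g s); last first.
    by rewrite gE //; apply/eqP; apply: contraNT sD => /fD[].
  apply: eq_bigr => x xs; congr (_ * _); rewrite /g1 /res.
  case: ifPn => //; rewrite in_setD negb_and negbK => /orP[xD|xU].
    by case/negP: sD; apply: (lD s (x |: s)) => //; apply: subsetUr.
  by apply/esym/eqP; apply: contraNT xU => /gU[].
have hU : supported i.+2 U h by move=> s /hW[/setDP[]].
exists (fun s => g s - res U (bdry h) s).
  move=> s; rewrite /res; case: ifPn => sU; last first.
    by rewrite subr0 => /gU[sU']; rewrite sU' in sU.
  case: (boolP (s \in D)) => sD nz.
    split=> //; apply/eqP; apply: contraNT nz => si; rewrite subr_eq0; apply/eqP.
    transitivity (0 : K).
      by apply/eqP; apply: contraNT si => /gU[_ ->].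
    by apply/esym/eqP; apply: contraNT si => /(supported_bdry hU) ->.
  have sW : s \in U :\: D by rewrite inE sD.
  by move: nz; rewrite hE // /g1 /res sW subrr eqxx.
move=> s sD; have sU := subsetP DU s sD.
by rewrite bdryB (bdry_res_bdry cU hU sU) subr0 gE.
Qed.

(** Adding the vertex [x] is a contracting homotopy, as for a cone with apex [x]; it sends a cycle
    [f] to the filling [g]. *)
Lemma acyc_toggle i U x : (forall s, (x |: s \in U) = (s \in U)) -> acyc i U.
Proof.
move=> xU f fU f0.
pose g s := if x \in s then inc_sign K (s :\ x) x * f (s :\ x) else 0.
have gx s : x \notin s -> g (x |: s) = inc_sign K s x * f s.
  by move=> xs; rewrite /g setU11 setU1K.
exists g => [s|s sU].
  rewrite /g; case: ifP => [xs|]; last by rewrite eqxx.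
  rewrite -(setD1K xs) xU setU1K ?setD11 // cardsU1 setD11 add1n => nz.
  have [|-> ->] // := fU (s :\ x).
  by apply: contra_neq nz => ->; rewrite mulr0.
case: (boolP (x \in s)) => xs; last first.
  rewrite /bdry (bigD1 x) //= gx // mulrA inc_signK mul1r big1 ?addr0 // => y /andP[ys yx].
  by rewrite /g !inE eq_sym (negbTE yx) (negbTE xs) mulr0.
set r := s :\ x; have xr : x \notin r by rewrite setD11.
have sE : s = x |: r by rewrite setD1K.
clearbody r.
have rU : r \in U by rewrite -xU -sE.
(* The cycle condition at [r] expresses the value of [f] at [x |: r] through the other cofaces of
   [r]. *)
have := f0 _ rU; rewrite /bdry (bigD1 x) //= -sE => /eqP; rewrite addr_eq0 => /eqP fs.
rewrite -[RHS]mul1r -(inc_signK K r x) -mulrA fs mulrN -mulNr big_distrr /=.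
apply: eq_big => [y|y ys].
  by rewrite {1}sE !inE negb_or andbC.
have yx : y != x by apply: contraNneq ys => ->.
have yr : y \notin r by apply: contraNN ys; rewrite sE => yr; rewrite inE yr orbT.
have -> : y |: s = x |: (y |: r) by rewrite sE setUCA.
rewrite gx; last by rewrite !inE eq_sym negb_or yx.
by rewrite !mulrA sE inc_sign_swap ?(eq_sym x) // mulNr.
Qed.

End RelativeAcyclicity.

(** * Sets of monomials stratified by their least common multiple *)

Section LcmStrata.

Variables (K : fieldType) (n N : nat) (g : 'I_N -> 'X_{1..n}).
Implicit Types (q r s t : {set 'I_N}) (m V : 'X_{1..n}) (x y : 'I_N).

Lemma lem_anti m1 m2 : (m1 <= m2)%MM -> (m2 <= m1)%MM -> m1 = m2.
Proof.
move=> /mnm_lepP m12 /mnm_lepP m21; apply/mnmP=> i; apply/eqP.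
by rewrite eqn_leq m12 m21.
Qed.

Lemma lem_mdeg m1 m2 : (m1 <= m2)%MM -> (mdeg m1 <= mdeg m2)%N.
Proof. by move=> /mnm_lepP m12; rewrite !mdegE leq_sum. Qed.

Lemma lem_mdeg_eq m1 m2 : (m1 <= m2)%MM -> mdeg m1 = mdeg m2 -> m1 = m2.
Proof.
move=> m12 /eqP; rewrite -(submK m12) mdegD -[X in X == _]add0n eqn_add2r eq_sym.
by rewrite mdeg_eq0 => /eqP ->; rewrite add0m.
Qed.

Definition lcms s : 'X_{1..n} := [multinom \max_(x in s) g x i | i < n].

Lemma lcmsP s m : reflect {in s, forall x, (g x <= m)%MM} (lcms s <= m)%MM.
Proof.
apply: (iffP mnm_lepP) => [le x xs|le i].
  apply/mnm_lepP => i; apply: leq_trans (le i); rewrite mnmE.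
  exact: (@leq_bigmax_cond _ (mem s) (fun x => g x i)).
by rewrite mnmE; apply/bigmax_leqP => x xs; apply/mnm_lepP/le.
Qed.

Lemma lem_lcms s x : x \in s -> (g x <= lcms s)%MM.
Proof. by move: x; apply/lcmsP/lepm_refl. Qed.

Lemma lcmsS s t : s \subset t -> (lcms s <= lcms t)%MM.
Proof. by move=> /subsetP st; apply/lcmsP => x /st; apply: lem_lcms. Qed.

Lemma lcms_leU1 s x m : (lcms (x |: s) <= m)%MM = (g x <= m)%MM && (lcms s <= m)%MM.
Proof.
apply/lcmsP/andP => [le|[xm /lcmsP sm] y].
  split; first by apply: le; rewrite setU11.
  by apply/lcmsP => y ys; apply: le; rewrite inE ys orbT.
by rewrite inE => /orP[/set1P ->|/sm].
Qed.

Lemma lcms0 : lcms set0 = 0%MM.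
Proof. by apply/mnmP => i; rewrite mnmE big_set0 mnm0E. Qed.

Definition stratum V := [set s | lcms s == V].

(** Induction on the size of [U]. The stratum whose lcm has the largest degree is closed under
    supersets in [U], so it is a quotient of the complex, and [acyc_ext] peels it off. *)
Lemma acyc_strata i U : convex U ->
    (forall s t, lcms s = lcms t -> s \in U -> t \in U) ->
    {in U, forall s, acyc K i (stratum (lcms s))} -> acyc K i U.
Proof.
have [k] := ubnP #|U|; elim: k U => // k IH U Uk cU sU aU.
case: (set_0Vmem U) => [->|[s0 s0U]].
  move=> f f0 _; exists (fun=> 0) => [s|s]; first by rewrite eqxx.
  by rewrite inE.
pose s := [arg max_(t > s0 in U) mdeg (lcms t)].
have [{}sU' smax] : s \in U /\ {in U, forall t, (mdeg (lcms t) <= mdeg (lcms s))%N}.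
  by rewrite /s; case: arg_maxnP.
pose D := U :\: stratum (lcms s).
have WE : U :\: D = stratum (lcms s).
  apply/setP => t; rewrite !inE; case: eqP => [E|] /=; last by case: (_ \in U).
  exact: sU (esym E) sU'.
have topS r t : r \subset t -> lcms r = lcms s -> t \in U -> lcms t = lcms s.
  move=> rt rs tU; apply/esym/lem_mdeg_eq; first by rewrite -rs lcmsS.
  by apply/eqP; rewrite eqn_leq smax // andbT -rs lem_mdeg // lcmsS.
have lD : lower D U.
  split; first exact: subsetDl.
  move=> r t rt; rewrite !inE => /andP[nt tU] ->; rewrite andbT.
  by apply: contraNN nt => /eqP rs; rewrite (topS r t).
apply: (acyc_ext cU lD); last by rewrite WE; apply: aU.
apply: IH.
- apply: (@leq_trans #|U|) => //.
  apply: proper_card; apply/properP; split; first exact: subsetDl.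
  by exists s; rewrite // !inE eqxx.
- move=> r t q rt tq; rewrite !inE => /andP[_ rU] /andP[nq qU].
  rewrite (cU r t q) // andbT.
  by apply: contraNN nq => /eqP ts; rewrite (topS t q).
- by move=> r t rt; rewrite !inE rt => /andP[-> /=]; apply: sU.
- by move=> t; rewrite !inE => /andP[_]; apply: aU.
Qed.

Lemma convex_lower (D U : {set {set 'I_N}}) : convex U -> lower D U -> convex D.
Proof.
move=> cU [/subsetP DU lD] r s t rs st rD tD.
by apply: (lD s t) => //; apply: (cU r s t) => //; apply: DU.
Qed.

Lemma lowerD (B U : {set {set 'I_N}}) :
  (forall s t, s \subset t -> s \in B -> t \in U -> t \in B) -> lower (U :\: B) U.
Proof.
move=> uB; split=> [|s t st]; first exact: subsetDl.
by rewrite !inE => /andP[tB tU] ->; rewrite andbT; apply: contraNN tB => /uB->.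
Qed.

(** For [m] dividing [V] these are the sets whose lcm with [m] is [V] (see [fiberP]). The two
    divisibilities make monotonicity in the set and in [m] immediate. *)
Definition join_fiber V m := [set s | (lcms s <= V)%MM && (V <= mlcm (lcms s) m)%MM].

Lemma mlcm_lcmsU1 x s m : (g x <= m)%MM -> mlcm (lcms (x |: s)) m = mlcm (lcms s) m.
Proof.
move=> xm; apply: lem_anti; rewrite lem_mlcm lem_mlcmr andbT; last first.
  apply: lepm_trans (lem_mlcml _ _); exact/lcmsS/subsetUr.
by rewrite lcms_leU1 lem_mlcml andbT; apply: lepm_trans (lem_mlcmr _ _).
Qed.

Lemma mlcm_leS m1 m2 k1 k2 : (m1 <= k1)%MM -> (m2 <= k2)%MM ->
  (mlcm m1 m2 <= mlcm k1 k2)%MM.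
Proof.
move=> mk1 mk2; rewrite lem_mlcm.
by rewrite (lepm_trans mk1 (lem_mlcml _ _)) (lepm_trans mk2 (lem_mlcmr _ _)).
Qed.

Lemma convex_fiber V m : convex (join_fiber V m).
Proof.
move=> r s t rs st; rewrite !inE => /andP[_ Vr] /andP[tV _]; apply/andP; split.
  exact: lepm_trans (lcmsS st) tV.
by apply: lepm_trans Vr _; apply: mlcm_leS; rewrite ?lepm_refl ?lcmsS.
Qed.

Lemma fiber_up V m s t :
  s \subset t -> s \in join_fiber V m -> (lcms t <= V)%MM -> t \in join_fiber V m.
Proof.
move=> st; rewrite !inE => /andP[_ Vs] ->.
by apply: lepm_trans Vs _; apply: mlcm_leS; rewrite ?lepm_refl ?lcmsS.
Qed.

Lemma fiber_le V m s : s \in join_fiber V m -> (lcms s <= V)%MM.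
Proof. by rewrite inE => /andP[]. Qed.

(** Adding or removing [x] affects neither of the two divisibilities, so [acyc_toggle] applies. *)
Lemma acyc_fiber i V m x :
  (g x <= V)%MM -> (g x <= m)%MM -> acyc K i (join_fiber V m).
Proof.
move=> xV xm; apply: (acyc_toggle (x := x)) => s.
by rewrite !inE lcms_leU1 xV mlcm_lcmsU1.
Qed.

Lemma fiber_stratum V m : stratum V \subset join_fiber V m.
Proof. by apply/subsetP => s; rewrite !inE => /eqP ->; rewrite lepm_refl lem_mlcml. Qed.

Lemma fiberS V m m' : (m <= m')%MM -> join_fiber V m \subset join_fiber V m'.
Proof.
move=> mm'; apply/subsetP => s; rewrite !inE => /andP[-> Vs] /=.
by apply: lepm_trans Vs _; apply: mlcm_leS; rewrite ?lepm_refl.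
Qed.

Lemma fiberP V m s : (m <= V)%MM -> s \in join_fiber V m -> mlcm (lcms s) m = V.
Proof.
by move=> mV; rewrite inE => /andP[sV Vs]; apply: lem_anti => //; rewrite lem_mlcm sV.
Qed.

(** The stratum of [V] is closed under supersets in [X], hence is the quotient of [X] by the union
    of the other strata, which is acyclic in degree [i] by [acyc_strata]. *)
Lemma acyc_top i V (X : {set {set 'I_N}}) : convex X -> stratum V \subset X ->
    {in X, forall s, (lcms s <= V)%MM} ->
    (forall s t, lcms s = lcms t -> s \in X -> t \in X) ->
    {in X, forall s, lcms s != V -> acyc K i (stratum (lcms s))} ->
  acyc K i.+1 X -> acyc K i.+1 (stratum V).
Proof.
move=> cX VX XV sX aX aXX.
have lX : lower (X :\: stratum V) X.
  apply: lowerD => s t /lcmsS st; rewrite !inE => /eqP sV /XV tV.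
  by apply/eqP/lem_anti; rewrite // -sV.
have -> : stratum V = X :\: (X :\: stratum V).
  by rewrite setDDr setDv set0U; apply/esym/setIidPr.
apply: (acyc_quo cX lX aXX); apply: acyc_strata.
- exact: convex_lower lX.
- by move=> s t st; rewrite !inE st => /andP[->]; apply: sX.
- by move=> s; rewrite !inE => /andP[nV sX']; apply: aX.
Qed.

Lemma fiber_saturated V m s t :
  lcms s = lcms t -> s \in join_fiber V m -> t \in join_fiber V m.
Proof. by move=> st; rewrite !inE st. Qed.

Lemma nacyc_step i V x : (g x <= V)%MM -> ~ acyc K i.+1 (stratum V) ->
  exists2 W, ~ acyc K i (stratum W) & mlcm W (g x) = V.
Proof.
move=> xV nV; apply: NNPP => nW; apply: nV.
apply: (@acyc_top i V (join_fiber V (g x))).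
- exact: convex_fiber.
- exact: fiber_stratum.
- by move=> s /fiber_le.
- exact: fiber_saturated.
- move=> s sX _; apply: NNPP => ns; apply: nW; exists (lcms s) => //.
  exact: fiberP sX.
- by apply: acyc_fiber xV _; apply: lepm_refl.
Qed.

Lemma nacyc_step2 i V x y : (g x <= V)%MM -> (g y <= V)%MM ->
  ~ acyc K i.+2 (stratum V) ->
  (exists W, [/\ ~ acyc K i.+1 (stratum W), mlcm W (g x) = V & mlcm W (g y) = V]) \/
  (exists2 W, ~ acyc K i (stratum W) & mlcm W (mlcm (g x) (g y)) = V).
Proof.
move=> xV yV nV; apply: NNPP => /not_or_and[nW1 nW2]; apply: nV.
set Ax := join_fiber V (g x); set Ay := join_fiber V (g y).
set U := join_fiber V (mlcm (g x) (g y)).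
have AxU : Ax \subset U by apply/fiberS/lem_mlcml.
have AyU : Ay \subset U by apply/fiberS/lem_mlcmr.
have cU : convex U by apply: convex_fiber.
have upU s t : s \subset t -> s \in Ax :|: Ay -> t \in U -> t \in Ax :|: Ay.
  move=> st; rewrite in_setU => sA /fiber_le tV.
  by case/orP: sA => /(fiber_up st)/(_ tV) tA; rewrite in_setU tA ?orbT.
(* Up to shifts by one, the homology passes from [U] minus the union of the two
   fibers to their union (as [U] is acyclic), to [Ax :\: Ay] (as [Ay] is), to
   [Ax :&: Ay] (as [Ax] is), and finally to the stratum of [V], its top part. *)
have aUA : acyc K i.+1 (Ax :|: Ay).
  have -> : Ax :|: Ay = U :\: (U :\: (Ax :|: Ay)).
    rewrite setDDr setDv set0U; apply/esym/setIidPr.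
    by rewrite subUset AxU.
  apply: (acyc_quo cU (lowerD upU)).
    by apply: acyc_fiber xV _; apply: lem_mlcml.
  apply: acyc_strata.
  - exact: convex_lower (lowerD upU).
  - by move=> s t st; rewrite !inE st.
  (* Every lcm occurring here joins with both generators to [V], so homology in degree [i] would
     give the second alternative. *)
  - move=> s /setDP[sU _]; apply: NNPP => ns; apply: nW2; exists (lcms s) => //.
    by apply: fiberP sU; rewrite lem_mlcm xV.
have cA : convex (Ax :|: Ay).
  move=> r s t rs st rA tA; apply: (upU r) => //.
  apply: (cU r s t) => //.
    by move: rA; rewrite in_setU => /orP[/(subsetP AxU)|/(subsetP AyU)].
  by move: tA; rewrite in_setU => /orP[/(subsetP AxU)|/(subsetP AyU)].
have aD : acyc K i.+1 (Ax :\: Ay).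
  have lD : lower (Ax :\: Ay) (Ax :|: Ay).
    have -> : Ax :\: Ay = (Ax :|: Ay) :\: Ay by rewrite setDUl setDv setU0.
    apply: lowerD => s t st sA tA; apply: (fiber_up st sA).
    by move: tA; rewrite in_setU => /orP[] /fiber_le.
  apply: (acyc_sub cA lD) => //.
  have -> : (Ax :|: Ay) :\: (Ax :\: Ay) = Ay.
    by apply/setP => s; rewrite !in_setD !in_setU; case: (s \in Ax); case: (s \in Ay).
  by apply: acyc_fiber yV _; apply: lepm_refl.
have aI : acyc K i.+2 (Ax :&: Ay).
  have -> : Ax :&: Ay = Ax :\: (Ax :\: Ay) by rewrite setDDr setDv set0U.
  apply: (acyc_quo (@convex_fiber _ _) _ _ aD).
    by apply: lowerD => s t st sA /fiber_le; apply: fiber_up sA.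
  by apply: acyc_fiber xV _; apply: lepm_refl.
apply: (@acyc_top i.+1 V (Ax :&: Ay)) => //.
- move=> r s t rs st /setIP[rx ry] /setIP[tx ty]; rewrite in_setI.
  by rewrite !(@convex_fiber _ _ r s t).
- by rewrite subsetI !fiber_stratum.
- by move=> s /setIP[/fiber_le].
- by move=> s t st; rewrite !in_setI => /andP[/(fiber_saturated st)-> /(fiber_saturated st)->].
(* An lcm in both fibers joins to [V] with each generator separately, so homology in degree [i.+1]
   would give the first alternative. *)
- move=> s /setIP[sx sy] _; apply: NNPP => ns; apply: nW1; exists (lcms s).
  by split=> //; apply: fiberP.
Qed.

Lemma nacyc_card i V : ~ acyc K i (stratum V) -> exists2 s, lcms s = V & #|s| = i.
Proof.
move=> nV; apply: NNPP => ns; apply: nV => f fV _.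
have f0 s : f s = 0.
  apply/eqP/negPn/negP => /fV[]; rewrite inE => /eqP sV si.
  by apply: ns; exists s.
exists (fun=> 0) => [s|s _]; first by rewrite eqxx.
by rewrite f0; apply: big1 => x _; rewrite mulr0.
Qed.

(** The stratum is the single face [s], so its complex is one-dimensional with zero boundary. *)
Lemma nacyc_isolated s : (forall t, lcms t = lcms s -> t = s) ->
  ~ acyc K #|s| (stratum (lcms s)).
Proof.
move=> uniq_s aV; case: (aV (fun t => (t == s)%:R)) => [t|t|h hs /(_ s)].
- by case: (eqVneq t s) => [->|] /=; rewrite ?eqxx // inE eqxx.
- rewrite inE => /eqP/uniq_s ->; apply: big1 => x xs.
  by case: eqP => [sE|]; rewrite ?mulr0 //; rewrite -sE setU11 in xs.
rewrite inE !eqxx => /(_ isT)/eqP; rewrite [bdry _ _]big1 => [|x xs].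
  by rewrite eq_sym oner_eq0.
case: (eqVneq (h (x |: s)) 0) => [->|/hs[]]; first by rewrite mulr0.
rewrite inE => /eqP/uniq_s ->; move=> /eqP.
by rewrite -[X in X == _]addn0 -addn1 eqn_add2l.
Qed.

Definition mgcd (m1 m2 : 'X_{1..n}) : 'X_{1..n} := [multinom minn (m1 i) (m2 i) | i < n].

Lemma mdeg_lcm_gcd m1 m2 : (mdeg (mlcm m1 m2) + mdeg (mgcd m1 m2) = mdeg m1 + mdeg m2)%N.
Proof.
rewrite -!mdegD; congr mdeg; apply/mnmP => i; rewrite !mnmDE !mnmE maxnE minnE; lia.
Qed.

Lemma mlcm_le_add m1 m2 : (mdeg (mlcm m1 m2) <= mdeg m1 + mdeg m2)%N.
Proof. by rewrite -mdeg_lcm_gcd leq_addr. Qed.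

Lemma nacyc_deg_step d i V : (forall x, (mdeg (g x) <= d)%N) ->
    ~ acyc K i.+1 (stratum V) ->
  exists2 W, ~ acyc K i (stratum W) & (mdeg V <= mdeg W + d)%N.
Proof.
move=> gd nV; have [s sV sc] := nacyc_card nV.
have /card_gt0P[x xs] : (0 < #|s|)%N by rewrite sc.
have xV : (g x <= V)%MM by rewrite -sV lem_lcms.
have [W nW WV] := nacyc_step xV nV; exists W => //.
by rewrite -WV (leq_trans (mlcm_le_add _ _)) // leq_add2l.
Qed.

(** * Degree drops between multidegrees with nonzero homology *)

Section DegreeBounds.

Variables (e d : nat).
Hypotheses (e_gt0 : (0 < e)%N) (g_deg : forall x, (e <= mdeg (g x) <= d)%N).
Hypothesis g_anti : forall x y, (g x <= g y)%MM -> x = y.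

(** Take [k] elements of [s]. Under coprimality their lcm is their product and determines them, so
    its stratum is a single face. *)
Lemma nacyc_coprime V s k : lcms s = V -> (k <= #|s|)%N ->
    (forall x y, (g x <= V)%MM -> (g y <= V)%MM -> x != y -> mgcd (g x) (g y) = 0%MM) ->
  exists2 W, ~ acyc K k (stratum W) & (k * e <= mdeg W)%N.
Proof.
move=> sV ks cop.
have [t ts <-] : exists2 t : {set 'I_N}, t \subset s & #|t| = k.
  have : (0 < #|[set t : {set 'I_N} | t \subset s & #|t| == k]|)%N.
    by rewrite cards_draws bin_gt0.
  by case/card_gt0P => t; rewrite inE => /andP[? /eqP]; exists t.
have tV : (lcms t <= V)%MM by rewrite -sV lcmsS.
have cop0 x y i : (g x <= V)%MM -> (g y <= V)%MM -> x != y ->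
    (0 < g x i)%N -> g y i = 0%N.
  move=> xV yV xy xi; move/mnmP/(_ i): (cop x y xV yV xy).
  by rewrite mnmE mnm0E; lia.
(* An element of [r] outside [q] would involve a variable that, by coprimality, no element of [q]
   involves; yet it divides the lcm of [q]. *)
have disj r q : lcms r = lcms q -> (lcms q <= V)%MM -> r \subset q.
  move=> rq qV; apply/subsetP => x xr; apply/negPn/negP => xq.
  have xle : (g x <= lcms q)%MM by rewrite -rq lem_lcms.
  have [i xi] : exists i, (0 < g x i)%N.
    apply/existsP; apply: contraLR e_gt0 => /existsPn x0; rewrite -eqn0Ngt -leqn0.
    case/andP: (g_deg x) => + _; rewrite mdegE big1 // => i _.
    by apply/eqP; rewrite eqn0Ngt.
  move/mnm_lepP/(_ i): (xle); rewrite mnmE leqNgt big1 ?xi // => y yq.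
  apply: (cop0 x) => //; try exact: lepm_trans qV.
    by apply: lepm_trans qV; apply: lem_lcms.
  by apply: contraNneq xq => ->.
exists (lcms t).
  apply: nacyc_isolated => r rt; apply/eqP; rewrite eqEsubset.
  by rewrite !disj // rt.
(* At most one element of [t] involves the variable [i], so sum and maximum of the exponents
   agree. *)
have E i : (\sum_(x in t) g x i <= lcms t i)%N.
  case: (pickP (fun x => (x \in t) && (0 < g x i)%N)) => [x /andP[xt xi]|no].
    rewrite (bigD1 x) //= big1 ?addn0 => [|y /andP[yt yx]].
      by move/mnm_lepP: (lem_lcms xt).
    by apply: (cop0 x) => //; rewrite 1?eq_sym //; apply: lepm_trans tV; apply: lem_lcms.
  rewrite big1 // => x xt; have := no x; rewrite /= xt /=.
  by case: (g x i).
rewrite mdegE; apply: leq_trans (leq_sum _ (fun i _ => E i)).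
rewrite exchange_big /= -sum_nat_const; apply: leq_sum => x _.
by rewrite -mdegE; case/andP: (g_deg x).
Qed.

Lemma nacyc_deg_step2 i V : ~ acyc K i.+2 (stratum V) ->
  (forall k, (k <= i.+2)%N -> exists2 W, ~ acyc K k (stratum W) & (k * e <= mdeg W)%N) \/
  (exists2 W, ~ acyc K i (stratum W) & (mdeg V < mdeg W + d.*2)%N).
Proof.
move=> nV; have [s sV sc] := nacyc_card nV.
case: (classic (exists x y, [/\ (g x <= V)%MM, (g y <= V)%MM, x != y &
                                mgcd (g x) (g y) != 0%MM])); last first.
  move=> no; left => k ki; apply: (nacyc_coprime sV); rewrite ?sc // => x y xV yV xy.
  by apply/eqP/negPn/negP => gxy; apply: no; exists x, y.
move=> [x [y [xV yV xy gxy]]]; right.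
have [/andP[_ xd] /andP[_ yd]] := (g_deg x, g_deg y).
have gcd_gt0 : (0 < mdeg (mgcd (g x) (g y)))%N by rewrite lt0n mdeg_eq0.
(* A gcd of degree [d] would be all of [g x], which would then divide [g y]. *)
have gcd_lt : (mdeg (mgcd (g x) (g y)) < d)%N.
  apply: leq_trans xd; rewrite ltn_neqAle; apply/andP; split.
    apply: contra_neq xy => E; apply: g_anti.
    have <- : mgcd (g x) (g y) = g x.
      by apply: lem_mdeg_eq E; apply/mnm_lepP => j; rewrite mnmE geq_minl.
    by apply/mnm_lepP => j; rewrite mnmE geq_minr.
  by apply: lem_mdeg; apply/mnm_lepP => j; rewrite mnmE geq_minl.
have [[W [nW Wx Wy]]|[W nW WV]] := nacyc_step2 xV yV nV.
  have gd z : (mdeg (g z) <= d)%N by case/andP: (g_deg z).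
  have [W' nW' WW'] := nacyc_deg_step gd nW; exists W' => //.
  (* A variable whose exponent in [V] exceeds that in [W] has the same exponent in [g x], [g y] and
     [V]. Hence [V] divides [W] times the gcd. *)
  have : (mdeg V <= mdeg W + mdeg (mgcd (g x) (g y)))%N.
    rewrite -mdegD; apply: lem_mdeg; apply/mnm_lepP => j.
    move/mnmP/(_ j): Wx; move/mnmP/(_ j): Wy; rewrite !mnmE; lia.
  lia.
exists W => //; rewrite -WV.
have := mlcm_le_add W (mlcm (g x) (g y)); have := mdeg_lcm_gcd (g x) (g y); lia.
Qed.

End DegreeBounds.

End LcmStrata.

(** * Independence of the graded Betti numbers from the resolution *)

(** Serves to build chain maps and homotopies degree by degree: [Q] is the invariant that lets the
    construction continue, [Rel] ties consecutive terms together. *)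
Lemma dependent_choice_seq (X : nat -> Type) (Q : forall i, X i -> Prop)
    (Rel : forall i, X i -> X i.+1 -> Prop) :
    (exists x, Q 0%N x) ->
    (forall i x, Q i x -> exists y, Q i.+1 y /\ Rel i x y) ->
  exists f : forall i, X i, (forall i, Q i (f i)) /\ (forall i, Rel i (f i) (f i.+1)).
Proof.
move=> /constructive_indefinite_description x0 step.
pose next i (x : {x : X i | Q i x}) :=
  constructive_indefinite_description _ (step i (sval x) (svalP x)).
pose f := nat_rect (fun i => {x : X i | Q i x}) x0
  (fun i x => exist _ (sval (next i x)) (svalP (next i x)).1).
exists (fun i => sval (f i)); split=> i; first exact: svalP.
exact: (svalP (next i (f i))).2.
Qed.

(** * Restricting a polynomial to selected monomials *)

Section MonomialFilter.

Variables (R : nzRingType) (n : nat).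
Implicit Types (p q : {mpoly R[n]}) (P Q : pred 'X_{1..n}).

Definition mfilter P p : {mpoly R[n]} := \sum_(m <- msupp p | P m) p@_m *: 'X_[m].

Lemma mcoeff_mfilter P p m : (mfilter P p)@_m = if P m then p@_m else 0.
Proof.
rewrite /mfilter raddf_sum /=.
under eq_bigr do rewrite mcoeffZ mcoeffX.
case: (boolP (m \in msupp p)) => mp; last first.
  rewrite (memN_msupp_eq0 mp) if_same big_seq_cond big1 // => k /andP[kp _].
  by case: eqP kp => [->|]; rewrite ?(negbTE mp) ?mulr0.
rewrite -big_filter; case: ifP => Pm.
  rewrite (bigD1_seq m) ?mem_filter ?Pm ?mp ?filter_uniq ?msupp_uniq //=.
  rewrite eqxx mulr1 big1 ?addr0 // => k /negbTE ->; exact: mulr0.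
rewrite big_filter big1 // => k Pk; case: eqP => [km|]; rewrite ?mulr0 //.
by rewrite -km Pk in Pm.
Qed.

Lemma mfilter_sum I (r : seq I) (F : I -> {mpoly R[n]}) P :
  mfilter P (\sum_(i <- r) F i) = \sum_(i <- r) mfilter P (F i).
Proof.
apply/mpolyP => m; rewrite mcoeff_mfilter !raddf_sum /=.
under [RHS]eq_bigr do rewrite mcoeff_mfilter.
by case: ifP => // _; rewrite big1.
Qed.

Lemma mfilterB P p q : mfilter P (p - q) = mfilter P p - mfilter P q.
Proof.
apply/mpolyP => m; rewrite !(mcoeffB, mcoeff_mfilter).
by case: ifP => // _; rewrite subr0.
Qed.

Lemma mfilter_id P p : {in msupp p, forall m, P m} -> mfilter P p = p.
Proof.
move=> pP; apply/mpolyP => m; rewrite mcoeff_mfilter.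
case: (boolP (m \in msupp p)) => [/pP -> //|mp].
by rewrite (memN_msupp_eq0 mp) if_same.
Qed.

Lemma msupp_mfilter P p m : m \in msupp (mfilter P p) -> P m.
Proof. by rewrite mcoeff_msupp mcoeff_mfilter; case: ifP; rewrite ?eqxx. Qed.

(** For [q] homogeneous and [P], [Q] conditions on the degree: graded components commute with
    multiplication by [q]. *)
Lemma mfilterM P Q p q :
    {in msupp q, forall k m, P (m + k)%MM = Q m} ->
  mfilter P (p * q) = mfilter Q p * q.
Proof.
move=> PQ; apply/mpolyP => m; rewrite mcoeff_mfilter !mcoeffM.
case: ifP => Pm; last first.
  rewrite big1 // => -[k1 k2] /= /eqP mE; rewrite mcoeff_mfilter.
  case: (boolP (val k2 \in msupp q)) => [/PQ kQ|/memN_msupp_eq0 ->]; last by rewrite mulr0.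
  by rewrite -kQ -mE Pm mul0r.
apply: eq_bigr => -[k1 k2] /= /eqP mE; rewrite mcoeff_mfilter.
case: (boolP (val k2 \in msupp q)) => [/PQ kQ|/memN_msupp_eq0 ->]; last by rewrite !mulr0.
by rewrite -kQ -mE Pm.
Qed.

End MonomialFilter.

(** * Matrices of degree zero between shifted free modules *)

Section HomogeneousMatrices.

Variables (K : fieldType) (n : nat).
Local Notation S := {mpoly K[n]}.

Definition homog_mx r s (shr : 'I_r -> nat) (shs : 'I_s -> nat) (X : 'M[S]_(r, s)) :=
  forall k l m, m \in msupp (X k l) -> (mdeg m + shs l)%N = shr k.

Lemma homog_mxM q r s shq shr shs (X : 'M[S]_(q, r)) (Y : 'M[S]_(r, s)) :
  homog_mx shq shr X -> homog_mx shr shs Y -> homog_mx shq shs (X *m Y).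
Proof.
move=> hX hY k l m; rewrite mxE => /msupp_sum_le/flatten_mapP[j _].
move=> /msuppM_le/allpairsP[[m1 m2] /= [/hX E1 /hY E2 ->]].
by rewrite mdegD -addnA E2 E1.
Qed.

Lemma homog_mxB r s shr shs (X Y : 'M[S]_(r, s)) :
  homog_mx shr shs X -> homog_mx shr shs Y -> homog_mx shr shs (X - Y).
Proof.
move=> hX hY k l m; rewrite !mxE => /msuppB_le.
by rewrite mem_cat => /orP[/hX|/hY].
Qed.

Lemma homog_mx1 r (shr : 'I_r -> nat) : homog_mx shr shr 1%:M.
Proof.
move=> k l m; rewrite mxE; case: eqP => [->|_].
  by rewrite -mpolyC1 msuppC oner_eq0 inE => /eqP ->; rewrite mdeg0.
by rewrite msupp0.
Qed.

Definition hcomp_mx r s (shr : 'I_r -> nat) (shs : 'I_s -> nat) (X : 'M[S]_(r, s)) : 'M[S]_(r, s) :=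
  \matrix_(k, l) mfilter [pred m | (mdeg m + shs l)%N == shr k] (X k l).

Lemma homog_hcomp r s shr shs (X : 'M[S]_(r, s)) : homog_mx shr shs (hcomp_mx shr shs X).
Proof. by move=> k l m; rewrite mxE => /msupp_mfilter/eqP. Qed.

Lemma hcomp_id r s shr shs (X : 'M[S]_(r, s)) : homog_mx shr shs X -> hcomp_mx shr shs X = X.
Proof.
move=> hX; apply/matrixP => k l; rewrite mxE mfilter_id // => m /hX /= ->.
by rewrite eqxx.
Qed.

Lemma hcompM q r s shq shr shs (X : 'M[S]_(q, r)) (Y : 'M[S]_(r, s)) :
  homog_mx shr shs Y -> hcomp_mx shq shs (X *m Y) = hcomp_mx shq shr X *m Y.
Proof.
move=> hY; apply/matrixP => k l; rewrite !mxE mfilter_sum.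
apply: eq_bigr => j _; rewrite mxE; apply: mfilterM => m mY m' /=.
by rewrite mdegD -addnA (hY _ _ _ mY).
Qed.

Lemma rows_lift q r s (X : 'M[S]_(q, s)) (Y : 'M[S]_(r, s)) :
  (forall k, exists w, row k X = w *m Y) -> exists W, X = W *m Y.
Proof.
move=> /fin_all_exists[w wE]; exists (\matrix_k w k).
by apply/row_matrixP => k; rewrite wE row_mul rowK.
Qed.

(** Lifting row by row may give an inhomogeneous matrix. Its component of degree zero is still a
    lift, because [X] and [Y] are homogeneous. *)
Lemma homog_lift q r s shq shr shs (X : 'M[S]_(q, s)) (Y : 'M[S]_(r, s)) :
    homog_mx shq shs X -> homog_mx shr shs Y ->
    (forall k, exists w, row k X = w *m Y) ->
  exists W, homog_mx shq shr W /\ X = W *m Y.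
Proof.
move=> hX hY /rows_lift[W XE]; exists (hcomp_mx shq shr W).
by split; [apply: homog_hcomp|rewrite -(hcompM _ _ hY) -XE hcomp_id].
Qed.

End HomogeneousMatrices.

(** * Comparison maps and homotopies between graded free resolutions *)

Section MonomialIdeal.

Variables (K : fieldType) (n : nat) (I : {mpoly K[n]} -> Prop).
Hypothesis hI : monomial_ideal I.

Lemma monomial_ideal0 : I 0.
Proof. by have [A AE] := hI; apply/AE; exists [::]; rewrite big_nil. Qed.

Lemma monomial_idealD f g : I f -> I g -> I (f + g).
Proof.
have [A AE] := hI; move=> /AE[s [sA ->]] /AE[t [tA ->]]; apply/AE.
by exists (s ++ t); rewrite big_cat; split=> // c; rewrite mem_cat => /orP[/sA|/tA].
Qed.

Lemma monomial_idealM f g : I g -> I (f * g).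
Proof.
have [A AE] := hI; move=> /AE[s [sA ->]]; apply/AE.
exists [seq (f * c.1, c.2) | c <- s]; split=> [c /mapP[c' /sA ? ->] //|].
by rewrite big_map big_distrr; apply: eq_bigr => c _ /=; rewrite mulrA.
Qed.

Lemma monomial_idealB f g : I f -> I g -> I (f - g).
Proof.
by move=> If Ig; rewrite -mulN1r; apply: monomial_idealD => //; apply: monomial_idealM.
Qed.

Lemma monomial_idealE f : I f <-> {in msupp f, forall m, I 'X_[m]}.
Proof.
split=> [|If]; last first.
  rewrite [f]mpolyE big_seq; elim/big_rec: _ => [|m g mf]; first exact: monomial_ideal0.
  apply: monomial_idealD; rewrite -mul_mpolyC; exact/monomial_idealM/If.
have [A AE] := hI; move=> /AE[s [sA ->]] m /msupp_sum_le/flatten_mapP[[p k]].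
rewrite mem_filter /= => /sA Ak /msuppM_le/allpairsP[[m1 m2] /=].
rewrite msuppX inE => -[_ /eqP -> ->]; rewrite mpolyXD; apply: monomial_idealM.
apply/AE; exists [:: (1, k)]; rewrite big_seq1 mul1r; split=> // c.
by rewrite inE => /eqP ->.
Qed.

Lemma monomial_ideal_mfilter P f : I f -> I (mfilter P f).
Proof.
move=> /monomial_idealE If; apply/monomial_idealE => m.
by rewrite mcoeff_msupp mcoeff_mfilter; case: ifP => [_|]; rewrite ?eqxx // -mcoeff_msupp => /If.
Qed.

Implicit Types A B : graded_free_resolution I.

Lemma homog_gfr_diff A i :
  homog_mx (@gfr_shift _ _ _ A i.+1) (@gfr_shift _ _ _ A i) (gfr_diff A i).
Proof. by move=> k l m; apply: gfr_diff_homog. Qed.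

Lemma gfr_diff_comp A i : gfr_diff A i.+1 *m gfr_diff A i = 0.
Proof.
apply/row_matrixP => k; rewrite row0 row_mul.
by apply/gfr_exactS; exists (delta_mx 0 k); rewrite rowE.
Qed.

Lemma gfr_lift q A i (X : 'M_(q, gfr_rank A i.+1)) (sh : 'I_q -> nat) :
    homog_mx sh (@gfr_shift _ _ _ A i.+1) X -> X *m gfr_diff A i = 0 ->
  exists W, homog_mx sh (@gfr_shift _ _ _ A i.+2) W /\ X = W *m gfr_diff A i.+1.
Proof.
move=> hX X0; apply: homog_lift hX (@homog_gfr_diff A _) _ => k.
by apply/gfr_exactS; rewrite -row_mul X0 row0.
Qed.

Lemma gfr_lift0 q A (X : 'M_(q, gfr_rank A 0)) (sh : 'I_q -> nat) :
    homog_mx sh (@gfr_shift _ _ _ A 0%N) X -> (forall k, I ((X *m gfr_aug A) k 0)) ->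
  exists W, homog_mx sh (@gfr_shift _ _ _ A 1%N) W /\ X = W *m gfr_diff A 0.
Proof.
move=> hX X0; apply: homog_lift hX (@homog_gfr_diff A _) _ => k.
by apply/gfr_exact0; rewrite -row_mul mxE.
Qed.

Lemma gfr_diff_aug A k : I ((gfr_diff A 0 *m gfr_aug A) k 0).
Proof.
have := gfr_exact0 (row k (gfr_diff A 0)).
rewrite -row_mul mxE => ->; exists (delta_mx 0 k); exact: rowE.
Qed.

Lemma monomial_ideal_mulmx q r (X : 'M_(q, r)) (Y : 'cV_r) k :
  (forall l, I (Y l 0)) -> I ((X *m Y) k 0).
Proof.
move=> IY; rewrite mxE; elim/big_rec: _ => [|l g _]; first exact: monomial_ideal0.
by apply: monomial_idealD; apply: monomial_idealM.
Qed.

Lemma chain_map_exists A B :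
  exists f : forall i, 'M[{mpoly K[n]}]_(gfr_rank A i, gfr_rank B i),
    [/\ forall i, homog_mx (@gfr_shift _ _ _ A i) (@gfr_shift _ _ _ B i) (f i),
        forall k, I ((gfr_aug A - f 0%N *m gfr_aug B) k 0)
      & forall i, gfr_diff A i *m f i = f i.+1 *m gfr_diff B i].
Proof.
(* In positive degree the invariant says that the next composite lands in the kernel of the
   differential of [B], so that it can be lifted; in degree 0 it is compatibility with the
   augmentations modulo [I]. *)
pose Q i : 'M[{mpoly K[n]}]_(gfr_rank A i, gfr_rank B i) -> Prop :=
  match i with
  | 0%N => fun f => homog_mx (@gfr_shift _ _ _ A 0%N) (@gfr_shift _ _ _ B 0%N) f /\
      forall k, I ((gfr_aug A - f *m gfr_aug B) k 0)
  | i.+1 => fun f => homog_mx (@gfr_shift _ _ _ A i.+1) (@gfr_shift _ _ _ B i.+1) f /\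
      gfr_diff A i.+1 *m f *m gfr_diff B i = 0
  end.
have Qh i f : Q i f -> homog_mx (@gfr_shift _ _ _ A i) (@gfr_shift _ _ _ B i) f.
  by case: i f => [|i] f [].
have [||f [fQ fR]] := @dependent_choice_seq _ Q
  (fun i f f' => gfr_diff A i *m f = f' *m gfr_diff B i).
- have /fin_all_exists[v vE] k : exists v : 'rV_(gfr_rank B 0),
      I (gfr_aug A k 0 - (v *m gfr_aug B) 0 0) by apply: gfr_aug_surj.
  have hA : homog_mx (@gfr_shift _ _ _ A 0%N) (fun=> 0%N) (gfr_aug A).
    by move=> k l m; rewrite ord1 addn0; apply: gfr_aug_homog.
  have hB : homog_mx (@gfr_shift _ _ _ B 0%N) (fun=> 0%N) (gfr_aug B).
    by move=> k l m; rewrite ord1 addn0; apply: gfr_aug_homog.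
  (* The preimages [v k] need not be homogeneous. Their components of the right degree still work,
     since [I] is closed under taking homogeneous components. *)
  exists (hcomp_mx (@gfr_shift _ _ _ A 0%N) (@gfr_shift _ _ _ B 0%N) (\matrix_k v k)).
  split=> [|k]; first exact: homog_hcomp.
  rewrite -(hcompM _ _ hB) -[X in X - _](hcomp_id hA) !mxE -mfilterB.
  apply: monomial_ideal_mfilter; move: (vE k); rewrite !mxE.
  by congr (I (_ - _)); apply: eq_bigr => j _; rewrite mxE.
- move=> i f Qf.
  have [W [hW WE]] : exists W, homog_mx (@gfr_shift _ _ _ A i.+1) (@gfr_shift _ _ _ B i.+1) W
      /\ gfr_diff A i *m f = W *m gfr_diff B i.
    have hf := homog_mxM (@homog_gfr_diff A i) (Qh _ _ Qf).
    case: i f Qf hf => [|i] f [_ fE] hf; last exact: gfr_lift.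
    apply: gfr_lift0 => // k; rewrite -mulmxA.
    have -> : f *m gfr_aug B = gfr_aug A - (gfr_aug A - f *m gfr_aug B).
      by rewrite opprB addrC subrK.
    rewrite mulmxBr !mxE; apply: monomial_idealB.
      by have := @gfr_diff_aug A k; rewrite mxE.
    by have := monomial_ideal_mulmx (gfr_diff A 0) k fE; rewrite mxE.
  exists W; split=> //; split=> //.
  by rewrite -mulmxA -WE mulmxA gfr_diff_comp mul0mx.
exists f; split=> // [i|k]; first exact: Qh.
by case: (fQ 0%N).
Qed.

Lemma homotopy_exists A (f : forall i, 'M[{mpoly K[n]}]_(gfr_rank A i)) :
    (forall i, homog_mx (@gfr_shift _ _ _ A i) (@gfr_shift _ _ _ A i) (f i)) ->
    (forall k, I ((f 0%N *m gfr_aug A) k 0)) ->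
    (forall i, gfr_diff A i *m f i = f i.+1 *m gfr_diff A i) ->
  exists s : forall i, 'M[{mpoly K[n]}]_(gfr_rank A i, gfr_rank A i.+1),
    [/\ forall i, homog_mx (@gfr_shift _ _ _ A i) (@gfr_shift _ _ _ A i.+1) (s i),
        f 0%N = s 0%N *m gfr_diff A 0
      & forall i, f i.+1 = gfr_diff A i *m s i + s i.+1 *m gfr_diff A i.+1].
Proof.
move=> hf f0 fd.
(* The middle clause makes the next lift possible. The last one records the identity in degree 0,
   which has no preceding homotopy term and is not covered by the relation between consecutive
   terms. *)
pose Q i (s : 'M[{mpoly K[n]}]_(gfr_rank A i, gfr_rank A i.+1)) :=
  [/\ homog_mx (@gfr_shift _ _ _ A i) (@gfr_shift _ _ _ A i.+1) s,
      (f i.+1 - gfr_diff A i *m s) *m gfr_diff A i = 0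
    & i = 0%N -> f i = s *m gfr_diff A i].
have [||s [sQ sR]] := @dependent_choice_seq _ Q
  (fun i s s' => f i.+1 = gfr_diff A i *m s + s' *m gfr_diff A i.+1).
- have [W [hW WE]] := gfr_lift0 (hf 0%N) f0; exists W; split=> //.
  by rewrite mulmxBl -mulmxA -WE fd subrr.
- move=> i s [hs sE _].
  have [W [hW WE]] := gfr_lift (homog_mxB (hf _) (homog_mxM (@homog_gfr_diff A i) hs)) sE.
  have fE : f i.+1 = gfr_diff A i *m s + W *m gfr_diff A i.+1.
    by rewrite -WE addrC subrK.
  exists W; split=> //; split=> //.
  rewrite mulmxBl -fd -mulmxA -mulmxBr.
  have -> : f i.+1 - W *m gfr_diff A i.+1 = gfr_diff A i *m s by rewrite fE addrK.
  by rewrite mulmxA gfr_diff_comp mul0mx.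
exists s; split=> // [i|]; first by have [] := sQ i.
by have [_ _ ->] := sQ 0%N.
Qed.

End MonomialIdeal.

(** * Vanishing of graded Betti numbers is the same for all resolutions *)

Section BettiInvariance.

Variables (K : fieldType) (n : nat) (I : {mpoly K[n]} -> Prop).
Implicit Types F A B : graded_free_resolution I.

Definition in_degree r (sh : 'I_r -> nat) j (u : 'rV[K]_r) :=
  forall k, u 0 k != 0 -> sh k = j.

Definition tensor_cycle F i : 'rV[K]_(gfr_rank F i) -> Prop :=
  match i with
  | 0%N => fun=> True
  | i'.+1 => fun u => u *m tensor_diff F i' = 0
  end.

Lemma tensor_degreeP F i j (u : 'rV_(gfr_rank F i)) :
  reflect (in_degree (@gfr_shift _ _ _ F i) j u) (u <= tensor_degree F i j)%MS.
Proof.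
apply: (iffP idP) => [/submxP[w ->] k|hu].
  rewrite /tensor_degree mul_mx_diag !mxE.
  by case: (eqVneq (gfr_shift k) j) => // _; rewrite mulr0 eqxx.
apply/submxP; exists u; rewrite /tensor_degree mul_mx_diag.
apply/rowP => k; rewrite !mxE; case: (eqVneq (u 0 k) 0) => [->|/hu ->].
  by rewrite mul0r.
by rewrite eqxx mulr1.
Qed.

Lemma tensor_diff_comp F i : tensor_diff F i.+1 *m tensor_diff F i = 0.
Proof.
by rewrite /tensor_diff -map_mxM gfr_diff_comp map_mx0.
Qed.

Lemma in_degree_homog r s (shr : 'I_r -> nat) (shs : 'I_s -> nat) (X : 'M[{mpoly K[n]}]_(r, s)) j u :
  homog_mx shr shs X -> in_degree shr j u ->
  in_degree shs j (u *m map_mx (mcoeff 0%MM) X).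
Proof.
move=> hX hu l; apply: contra_neq_eq => lj; rewrite mxE big1 // => k _.
case: (eqVneq (u 0 k) 0) => [->|/hu kj]; first by rewrite mul0r.
rewrite mxE; case: (boolP (0%MM \in msupp (X k l))) => [/hX E|/memN_msupp_eq0 ->].
  by rewrite mdeg0 add0n kj in E; rewrite E eqxx in lj.
by rewrite mulr0.
Qed.

Lemma in_degreeB r (sh : 'I_r -> nat) j u v :
  in_degree sh j u -> in_degree sh j v -> in_degree sh j (u - v).
Proof.
move=> hu hv k; rewrite !mxE; case: (eqVneq (u 0 k) 0) => [->|/hu//].
by rewrite sub0r oppr_eq0 => /hv.
Qed.

Lemma tensor_cyclesP F i j (u : 'rV_(gfr_rank F i)) :
  (u <= tensor_cycles F i j)%MS <->
  in_degree (@gfr_shift _ _ _ F i) j u /\ tensor_cycle u.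
Proof.
case: i u => [|i] u /=; first by split=> [/tensor_degreeP|[/tensor_degreeP]].
rewrite sub_capmx; split=> [/andP[/tensor_degreeP hu /sub_kermxP]//|[hu u0]].
by apply/andP; split; [apply/tensor_degreeP|apply/sub_kermxP].
Qed.

Lemma tensor_boundariesP F i j (u : 'rV_(gfr_rank F i)) :
  (u <= tensor_boundaries F i j)%MS <->
  exists2 w, in_degree (@gfr_shift _ _ _ F i.+1) j w & u = w *m tensor_diff F i.
Proof.
rewrite /tensor_boundaries; split=> [/submxP[w ->]|[w /tensor_degreeP/submxP[v ->] ->]].
  exists (w *m tensor_degree F i.+1 j); last by rewrite mulmxA.
  by apply/tensor_degreeP/submxP; exists w.
by apply/submxP; exists v; rewrite mulmxA.
Qed.

Lemma graded_betti_eq0 F i j : graded_betti F i j = 0%N <->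
  (forall u : 'rV_(gfr_rank F i), in_degree (@gfr_shift _ _ _ F i) j u -> tensor_cycle u ->
    exists2 w, in_degree (@gfr_shift _ _ _ F i.+1) j w & u = w *m tensor_diff F i).
Proof.
(* [graded_betti] is a truncated difference of ranks; this inclusion turns its vanishing into the
   reverse inclusion. *)
have BC : (tensor_boundaries F i j <= tensor_cycles F i j)%MS.
  apply/row_subP => k; apply/tensor_cyclesP.
  have /tensor_boundariesP[w hw ->] := row_sub k (tensor_boundaries F i j).
  split; first exact: in_degree_homog (@homog_gfr_diff _ _ _ F i) hw.
  by case: i k w hw => [|i] //= k w _; rewrite -mulmxA tensor_diff_comp mulmx0.
transitivity (tensor_cycles F i j <= tensor_boundaries F i j)%MS.
  rewrite /graded_betti; split=> [/eqP|CB].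
    by rewrite subn_eq0 => rk; rewrite -(geq_leqif (mxrank_leqif_sup BC)).
  by apply/eqP; rewrite subn_eq0 mxrankS.
split=> [CB u hu u0|CB].
  apply/tensor_boundariesP; apply: submx_trans CB; exact/tensor_cyclesP.
apply/row_subP => k; have /tensor_cyclesP[hu u0] := row_sub k (tensor_cycles F i j).
exact/tensor_boundariesP/CB.
Qed.

Hypothesis hI : monomial_ideal I.

(** A cycle [u] of [A] is carried to [B], where it bounds, and back. The composite is homotopic to
    the identity, so [u] itself bounds. Transferring vanishing suffices for maximal shifts. *)
Lemma graded_betti_eq0_trans A B i j : graded_betti B i j = 0%N -> graded_betti A i j = 0%N.
Proof.
have [f [hf f0 fd]] := chain_map_exists hI A B.
have [g [hg g0 gd]] := chain_map_exists hI B A.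
pose h i := f i *m g i - 1%:M.
have [|||s [hs s0 sS]] := homotopy_exists (A := A) (f := h).
- by move=> k; apply: homog_mxB (homog_mxM _ _) (@homog_mx1 _ _ _ _); [apply: hf|apply: hg].
- move=> k; rewrite /h mulmxBl mul1mx -mulmxA -opprB.
  have -> : gfr_aug A - f 0%N *m (g 0%N *m gfr_aug A) =
      (gfr_aug A - f 0%N *m gfr_aug B) + f 0%N *m (gfr_aug B - g 0%N *m gfr_aug A).
    by rewrite mulmxBr addrA subrK.
  rewrite mxE -sub0r [X in _ - X]mxE; apply: (monomial_idealB hI).
    exact: monomial_ideal0.
  by apply: (monomial_idealD hI); last apply: (monomial_ideal_mulmx hI).
- by move=> k; rewrite /h mulmxBr mulmxBl mulmx1 mul1mx mulmxA fd -mulmxA gd mulmxA.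
(* After tensoring, the homotopy term that starts with the differential kills cycles, leaving only a
   boundary. *)
have hE k (u : 'rV_(gfr_rank A k)) : tensor_cycle u ->
    u *m map_mx (mcoeff 0%MM) (f k) *m map_mx (mcoeff 0%MM) (g k) - u =
    u *m map_mx (mcoeff 0%MM) (s k) *m tensor_diff A k.
  move=> u0; rewrite -!mulmxA -map_mxM.
  have -> : f k *m g k = 1%:M + h k by rewrite addrC subrK.
  rewrite map_mxD map_mx1 mulmxDr mulmx1 addrC addKr.
  case: k u u0 => [|k] u u0; first by rewrite s0 map_mxM.
  by rewrite sS map_mxD mulmxDr !map_mxM mulmxA u0 mul0mx add0r.
move=> /graded_betti_eq0 B0; apply/graded_betti_eq0 => u hu u0.
have [||w hw wE] := B0 (u *m map_mx (mcoeff 0%MM) (f i)).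
- exact: in_degree_homog (hf i) hu.
- case: i u hu u0 {B0} => [|i] //= u hu u0.
  by rewrite -mulmxA -map_mxM -fd map_mxM mulmxA u0 mul0mx.
exists (w *m map_mx (mcoeff 0%MM) (g i.+1) - u *m map_mx (mcoeff 0%MM) (s i)).
  apply: in_degreeB; first exact: in_degree_homog (hg _) hw.
  exact: in_degree_homog (hs i) hu.
rewrite mulmxBl -hE // wE -!mulmxA -!map_mxM gd.
by rewrite opprB addrC subrK.
Qed.

End BettiInvariance.

(** * The Taylor resolution *)

Lemma mcoeffXM (R : comNzRingType) (n : nat) (p : {mpoly R[n]}) m k :
  ('X_[m] * p)@_k = if (m <= k)%MM then p@_(k - m) else 0.
Proof.
rewrite mulrC; case: ifPn => [mk|mk]; first by rewrite -{1}(submK mk) addmC mcoeffMX.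
apply/memN_msupp_eq0; apply: contraNN mk => /msuppM_le/allpairsP[[m1 m2] /=].
by rewrite msuppX inE => -[_ /eqP -> ->]; apply: lem_addl.
Qed.

(** * Row vectors indexed by the subsets of a given size *)

Section SubsetCoordinates.

Variable N : nat.
Implicit Types (s t : {set 'I_N}) (i : nat).

Definition layer i : {set {set 'I_N}} := [set s : {set 'I_N} | #|s| == i].

Definition face i (k : 'I_#|layer i|) : {set 'I_N} := enum_val k.

Lemma card_face i (k : 'I_#|layer i|) : #|face k| = i.
Proof. by have := enum_valP k; rewrite inE => /eqP. Qed.

Lemma face_onto i s : #|s| = i -> exists k : 'I_#|layer i|, face k = s.
Proof.
move=> /eqP si; have sl : s \in layer i by rewrite inE.
by exists (enum_rank_in sl s); apply: enum_rankK_in.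
Qed.

Variable R : nzRingType.

(** Reads a row vector as a chain, extended by zero to sets of other sizes, so that [bdry] applies
    to it. *)
Definition on_faces i (v : 'rV[R]_#|layer i|) s := \sum_(k | face k == s) v 0 k.

Lemma on_faceE i (v : 'rV[R]_#|layer i|) k : on_faces v (face k) = v 0 k.
Proof.
rewrite /on_faces (big_pred1 k) // => l /=.
by apply/eqP/eqP => [/enum_val_inj|->].
Qed.

Lemma on_faces_out i (v : 'rV[R]_#|layer i|) s : #|s| <> i -> on_faces v s = 0.
Proof.
move=> si; rewrite /on_faces big1 // => k /eqP ks.
by case: si; rewrite -ks card_face.
Qed.

Lemma on_faces_eq i (v : 'rV[R]_#|layer i|) (f : {set 'I_N} -> R) :
    (forall s, f s != 0 -> #|s| = i) -> (forall k, v 0 k = f (face k)) ->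
  on_faces v =1 f.
Proof.
move=> fi vf s; case: (eqVneq #|s| i) => [si|/eqP si].
  by have [k <-] := face_onto si; rewrite on_faceE.
rewrite on_faces_out //; apply/esym/eqP/negPn/negP => /fi; exact: si.
Qed.

(* Each entry has at most one summand. *)
Definition incidence_mx (c : {set 'I_N} -> 'I_N -> R) i : 'M[R]_(#|layer i.+1|, #|layer i|) :=
  \matrix_(k, l) \sum_(x | (x \notin face l) && (x |: face l == face k)) c (face l) x.

End SubsetCoordinates.

Lemma incidence_mulmx (R : comNzRingType) N (c : {set 'I_N} -> 'I_N -> R) i
    (v : 'rV_#|layer N i.+1|) l :
  (v *m incidence_mx c i) 0 l =
  \sum_(x | x \notin face l) c (face l) x * on_faces v (x |: face l).
Proof.
rewrite mxE; under eq_bigr do rewrite mxE big_distrr /=.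
rewrite (exchange_big_dep (fun x => x \notin face l)) /= => [|k x _ /andP[] //].
apply: eq_bigr => x xl; rewrite big_distrr /=; apply: eq_big => [k|k _].
  by rewrite xl eq_sym.
by rewrite mulrC.
Qed.

(** * Exactness and homology of the Taylor complex *)

Section Taylor.

Variables (K : fieldType) (n N : nat) (g : 'I_N -> 'X_{1..n}).
Local Notation S := {mpoly K[n]}.
Local Notation lcms := (lcms g).
Implicit Types (s t : {set 'I_N}) (a b : 'X_{1..n}).

Definition taylor_diff i : 'M[S]_(#|layer N i.+1|, #|layer N i|) :=
  incidence_mx (fun t x => inc_sign S t x * 'X_[lcms (x |: t) - lcms t]) i.

Definition divisor_sets a : {set {set 'I_N}} := [set s | (lcms s <= a)%MM].

(* The part of multidegree [a], in the basis of the [X^(a - lcms s) e_s]. *)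
Definition mpart i (v : 'rV[S]_#|layer N i|) a s : K :=
  if (lcms s <= a)%MM then (on_faces v s)@_(a - lcms s) else 0.

Lemma convex_divisor_sets a : convex (divisor_sets a).
Proof. by move=> r s t rs st; rewrite !inE => _; apply: lepm_trans; apply: lcmsS. Qed.

Lemma mpart_supported i (v : 'rV[S]_#|layer N i|) a :
  supported i (divisor_sets a) (mpart v a).
Proof.
move=> s; rewrite /mpart inE; case: ifP => [sa nz|]; last by rewrite eqxx.
split=> //; apply/eqP; apply: contra_neqT nz => /eqP si.
by rewrite on_faces_out // mcoeff0.
Qed.

Lemma inc_sign_mpoly t x : inc_sign S t x = (inc_sign K t x)%:MP.
Proof. by rewrite /inc_sign rmorphXn rmorphN1. Qed.

(** In multidegree [a] the monomial coefficients of the Taylor differential become 1 and only the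
    signs remain: this is the simplicial boundary on [divisor_sets a]. *)
Lemma mpart_diff i (v : 'rV[S]_#|layer N i.+1|) a :
  mpart (v *m taylor_diff i) a =1 res (divisor_sets a) (bdry (mpart v a)).
Proof.
move=> s; rewrite /mpart /res inE; case: ifP => // sa.
case: (eqVneq #|s| i) => [si|/eqP si]; last first.
  rewrite on_faces_out // mcoeff0; apply/esym/eqP/negPn/negP.
  by move=> /(supported_bdry (@mpart_supported _ v a)).
have [k ks] := face_onto si; rewrite -ks in sa *.
rewrite on_faceE incidence_mulmx raddf_sum /=; apply: eq_bigr => x xk.
rewrite -mulrA inc_sign_mpoly mcoeffCM mcoeffXM; congr (_ * _).
rewrite /mpart; set t := face k in sa xk *; set t' := x |: t.
have tt' : (lcms t <= lcms t')%MM by apply/lcmsS/subsetUr.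
have -> : (lcms t' - lcms t <= a - lcms t)%MM = (lcms t' <= a)%MM.
  apply/mnm_lepP/mnm_lepP => le j; move: (le j); rewrite !mnmBE.
    by move/mnm_lepP/(_ j): sa; move/mnm_lepP/(_ j): tt'; lia.
  by lia.
case: ifP => // t'a; congr (_ @_ _); apply/mnmP => j; rewrite !mnmBE.
move/mnm_lepP/(_ j): sa; move/mnm_lepP/(_ j): tt'; move/mnm_lepP/(_ j): t'a; lia.
Qed.

Lemma mpart_inj i (v w : 'rV[S]_#|layer N i|) :
  (forall a, mpart v a =1 mpart w a) -> v = w.
Proof.
move=> vw; apply/rowP => k; apply/mpolyP => m.
have := vw (m + lcms (face k))%MM (face k).
by rewrite /mpart lem_addl addmK !on_faceE.
Qed.

Lemma mpart_sum i (I : Type) (r : seq I) (F : I -> 'rV[S]_#|layer N i|) a s :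
  mpart (\sum_(j <- r) F j) a s = \sum_(j <- r) mpart (F j) a s.
Proof.
rewrite /mpart; case: ifP => _; last by rewrite big1.
have -> : on_faces (\sum_(j <- r) F j) s = \sum_(j <- r) on_faces (F j) s.
  by rewrite /on_faces exchange_big; apply: eq_bigr => k _; rewrite summxE.
by rewrite raddf_sum.
Qed.

Lemma mpart_realize i a f : supported i (divisor_sets a) f ->
  exists w : 'rV[S]_#|layer N i|, forall b s, mpart w b s = if b == a then f s else 0.
Proof.
move=> fa; exists (\row_k (f (face k) *: 'X_[a - lcms (face k)])) => b s.
have E : on_faces (\row_(k < #|layer N i|) (f (face k) *: 'X_[a - lcms (face k)])) =1
    (fun s => f s *: 'X_[a - lcms s]).
  apply: on_faces_eq => [t|k]; last by rewrite mxE.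
  case: (eqVneq (f t) 0) => [->|/fa[]//]; by rewrite scale0r eqxx.
rewrite /mpart E mcoeffZ mcoeffX.
case: (eqVneq (f s) 0) => [->|/fa[]]; first by rewrite mul0r !if_same.
rewrite inE => sa _; case: (eqVneq b a) => [->|ba].
  by rewrite sa eqxx mulr1.
case: ifP => // sb; case: eqP => [ab|]; last by rewrite mulr0.
by case/eqP: ba; rewrite -(submK sb) -(submK sa) ab.
Qed.

Definition multidegrees i (v : 'rV[S]_#|layer N i|) : seq 'X_{1..n} :=
  undup (flatten [seq [seq (m + lcms (face k))%MM | m <- msupp (v 0 k)] | k <- enum 'I_#|layer N i|]).

Lemma mpart_multidegrees i (v : 'rV[S]_#|layer N i|) a s :
  a \notin multidegrees v -> mpart v a s = 0.
Proof.
apply: contraNeq => nz; have [sa si] := mpart_supported nz.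
have [k ks] := face_onto si; move: nz sa; rewrite /mpart -ks inE.
case: ifP => // ka nz _; rewrite mem_undup; apply/flatten_mapP; exists k.
  by rewrite mem_enum.
apply/mapP; exists (a - lcms (face k))%MM; last by rewrite submK.
by rewrite mcoeff_msupp -(on_faceE v k).
Qed.

(** Solve in each multidegree and add the solutions over the finitely many multidegrees of [v]. The
    alternative of a vanishing part serves degree 0, where [divisor_sets a] can be the empty face
    alone. *)
Lemma taylor_exact i (v : 'rV[S]_#|layer N i|) :
    (forall a, {in divisor_sets a, forall s, bdry (mpart v a) s = 0}) ->
    (forall a, (forall s, mpart v a s = 0) \/ acyc K i (divisor_sets a)) ->
  exists w, v = w *m taylor_diff i.
Proof.
move=> v0 va.
have ex a : exists f, supported i.+1 (divisor_sets a) f /\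
    {in divisor_sets a, forall s, bdry f s = mpart v a s}.
  case: (va a) => [z|aa].
    exists (fun=> 0); split=> [s|s sa]; first by rewrite eqxx.
    by rewrite z; apply: big1 => x _; rewrite mulr0.
  by have [f fa fE] := aa _ (@mpart_supported _ v a) (v0 a); exists f.
have exw a : exists w : 'rV[S]_#|layer N i.+1|, forall b s,
    mpart (w *m taylor_diff i) b s = if b == a then mpart v a s else 0.
  have [f [fa fE]] := ex a; have [w wE] := mpart_realize fa; exists w => b s.
  rewrite mpart_diff /res.
  case: (eqVneq b a) => [->|ba].
    case: ifPn => sa.
      rewrite -fE //; apply: eq_bigr => x _; by rewrite wE eqxx.
    by apply/esym/eqP; apply: contraNT sa => /mpart_supported[].
  case: ifP => // _; apply: big1 => x _; by rewrite wE (negbTE ba) mulr0.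
pose w a := sval (constructive_indefinite_description _ (exw a)).
have wE a b s : mpart (w a *m taylor_diff i) b s = if b == a then mpart v a s else 0.
  exact: svalP (constructive_indefinite_description _ (exw a)) b s.
exists (\sum_(a <- multidegrees v) w a); apply: mpart_inj => b s.
rewrite mulmx_suml mpart_sum; under eq_bigr do rewrite wE.
case: (boolP (b \in multidegrees v)) => bv.
  rewrite (bigD1_seq b) ?undup_uniq //= eqxx big1 ?addr0 // => a ab.
  by rewrite eq_sym (negbTE ab).
rewrite mpart_multidegrees // big_seq big1 // => a av.
by case: eqP => // ba; rewrite ba av in bv.
Qed.

Lemma acyc_divisor_sets i a x : (g x <= a)%MM -> acyc K i (divisor_sets a).
Proof.
by move=> xa; apply: (acyc_toggle (x := x)) => s; rewrite !inE lcms_leU1 xa.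
Qed.

(** Either some generator divides [a] and the faces form a full simplex, or only the empty face is
    present and there are no chains in positive degree. *)
Lemma acyc_divisor_sets_pos i a : acyc K i.+1 (divisor_sets a).
Proof.
case: (pickP (fun x => (g x <= a)%MM)) => [x|no]; first exact: acyc_divisor_sets.
move=> f fa _; have f0 s : f s = 0.
  apply/eqP/negPn/negP => /fa[]; rewrite inE => sa si.
  have /card_gt0P[x xs] : (0 < #|s|)%N by rewrite si.
  by have := no x; rewrite (lepm_trans (lem_lcms g xs) sa).
exists (fun=> 0) => [s|s _]; first by rewrite eqxx.
by rewrite f0; apply: big1 => x _; rewrite mulr0.
Qed.

Lemma taylor_exactS i (v : 'rV[S]_#|layer N i.+1|) :
  v *m taylor_diff i = 0 <-> exists w, v = w *m taylor_diff i.+1.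
Proof.
split=> [v0|[w ->]].
  apply: taylor_exact => a; last by right; apply: acyc_divisor_sets_pos.
  move=> s sa; have := mpart_diff v a s; rewrite v0 /res sa => <-.
  by rewrite /mpart /on_faces big1 ?mcoeff0 ?if_same // => k _; rewrite mxE.
apply: mpart_inj => a s; rewrite mpart_diff.
rewrite [RHS]/mpart [in RHS]/on_faces [in RHS]big1 ?mcoeff0 ?if_same; last first.
  by move=> k _; rewrite mxE.
rewrite /res; case: ifP => // sa.
rewrite -[RHS](bdry_res_bdry (@convex_divisor_sets a) (@mpart_supported _ w a) sa).
by apply: eq_bigr => x _; rewrite mpart_diff.
Qed.

Variable I : S -> Prop.
Hypothesis gI : forall f, I f <-> {in msupp f, forall m, exists x, (g x <= m)%MM}.

Definition taylor_aug : 'cV[S]_#|layer N 0| := const_mx 1.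

Lemma face0 (k : 'I_#|layer N 0|) : face k = set0.
Proof. by apply/eqP; rewrite -cards_eq0 card_face. Qed.

Lemma mul_taylor_aug (v : 'rV[S]_#|layer N 0|) : (v *m taylor_aug) 0 0 = on_faces v set0.
Proof.
rewrite mxE /on_faces; apply: eq_big => [k|k _]; first by rewrite face0 eqxx.
by rewrite mxE mulr1.
Qed.

Lemma taylor_exact0 (v : 'rV[S]_#|layer N 0|) :
  I ((v *m taylor_aug) 0 0) <-> exists w, v = w *m taylor_diff 0.
Proof.
rewrite mul_taylor_aug; split=> [/gI vI|[w ->]].
  apply: taylor_exact => a.
    move=> s _; apply/eqP/negPn/negP => nz.
    case/negP: nz; rewrite /bdry big1 // => x xs.
    case: (eqVneq (mpart v a (x |: s)) 0) => [->|/mpart_supported[_]].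
      by rewrite mulr0.
    by rewrite cardsU1 xs.
  (* A monomial of the support lies in [I], so a generator divides it; in the other multidegrees [v]
     has no part. *)
  case: (boolP (a \in msupp (on_faces v set0))) => [/vI[x xa]|/memN_msupp_eq0 a0].
    by right; apply: acyc_divisor_sets xa.
  left=> s; apply/eqP/negPn/negP => nz; have [_ /cards0_eq s0] := mpart_supported nz.
  by move: nz; rewrite s0 /mpart lcms0 subm0 a0 if_same eqxx.
apply/gI => m mw; have := mpart_diff w m set0.
rewrite /mpart lcms0 subm0 /res inE lcms0.
have -> : (0 <= m)%MM by apply/mnm_lepP => j; rewrite mnm0E.
move=> E; have nz : bdry (mpart w m) set0 != 0 by rewrite -E -mcoeff_msupp.
case: (pickP (fun x => mpart w m (x |: set0) != 0)) => [x /mpart_supported[]|no].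
  by rewrite inE lcms_leU1 => /andP[xm _] _; exists x.
case/negP: nz; rewrite /bdry big1 // => x _.
by have /negbFE/eqP -> := no x; rewrite mulr0.
Qed.

Definition taylor_shift i (k : 'I_#|layer N i|) := mdeg (lcms (face k)).

Lemma taylor_aug_homog k m : m \in msupp (taylor_aug k 0) -> mdeg m = taylor_shift k.
Proof.
rewrite mxE -mpolyC1 msuppC oner_eq0 inE => /eqP ->.
by rewrite /taylor_shift face0 lcms0.
Qed.

Lemma taylor_diff_homog i k l m : m \in msupp (taylor_diff i k l) ->
  (mdeg m + taylor_shift l)%N = taylor_shift k.
Proof.
rewrite mxE => /msupp_sum_le/flatten_mapP[x]; rewrite mem_filter => /andP[/andP[_ /eqP xE] _].
rewrite inc_sign_mpoly mul_mpolyC => /msuppZ_le; rewrite msuppX inE => /eqP ->.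
by rewrite -mdegD submK /taylor_shift ?xE // -xE; apply/lcmsS/subsetUr.
Qed.

Lemma taylor_aug_surj f : exists v : 'rV[S]_#|layer N 0|, I (f - (v *m taylor_aug) 0 0).
Proof.
exists (const_mx f); rewrite mul_taylor_aug.
have [k ks] := @face_onto N 0 set0 (cards0 _).
by rewrite -ks on_faceE mxE subrr; apply/gI => m; rewrite msupp0.
Qed.

Definition taylor_resolution : graded_free_resolution I :=
  @GradedFreeResolution K n I (fun i => #|layer N i|) taylor_shift taylor_aug taylor_diff
    taylor_aug_homog taylor_diff_homog taylor_aug_surj taylor_exact0 taylor_exactS.

(** An entry of the Taylor differential has a nonzero constant term only between faces with the same
    lcm, so tensoring with [K] splits the complex into the strata. *)
Lemma taylor_tensor_mul i (u : 'rV[K]_#|layer N i.+1|) l :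
  (u *m tensor_diff taylor_resolution i) 0 l =
  bdry (res (stratum g (lcms (face l))) (on_faces u)) (face l).
Proof.
have -> : tensor_diff taylor_resolution i = incidence_mx (fun t x =>
    inc_sign K t x * (lcms (x |: t) == lcms t)%:R) i.
  apply/matrixP => k {}l; rewrite !mxE raddf_sum /=; apply: eq_bigr => x _.
  rewrite inc_sign_mpoly mcoeffCM mcoeffX; congr (_ * (nat_of_bool _)%:R).
  have le : (lcms (face l) <= lcms (x |: face l))%MM by apply/lcmsS/subsetUr.
  apply/eqP/eqP => [E|->]; first by rewrite -(submK le) E add0m.
  by apply/mnmP => j; rewrite mnmBE mnm0E subnn.
rewrite incidence_mulmx; apply: eq_bigr => x _; rewrite -mulrA /res inE.
by case: eqP => _; rewrite ?mul1r ?mul0r.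
Qed.

Lemma taylor_betti_eq0 i j : graded_betti taylor_resolution i j = 0%N <->
  (forall V, mdeg V = j -> acyc K i (stratum g V)).
Proof.
split=> [/graded_betti_eq0 b0 V Vj f fV f0|aV].
  have fE : on_faces (\row_(k < #|layer N i|) f (face k)) =1 f.
    by apply: on_faces_eq => [s /fV[]|k] //; rewrite mxE.
  have [k|| w wj wE] := b0 (\row_k f (face k)).
  - by rewrite mxE => /fV[]; rewrite inE => /eqP + _; rewrite -Vj => <-.
  - case: i {b0} f fV f0 fE => [|i] //= f fV f0 fE.
    apply/rowP => l; rewrite taylor_tensor_mul mxE.
    case: (eqVneq (lcms (face l)) V) => lV.
      rewrite -[RHS](f0 (face l)) ?inE ?lV //; apply: eq_bigr => x _.
      rewrite /res fE; case: ifPn => // xV; congr (_ * _).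
      by apply/esym/eqP; apply: contraNT xV => /fV[].
    apply: big1 => x _; rewrite /res fE inE; case: eqP => xV; rewrite ?mulr0 //.
    case: (eqVneq (f (x |: face l)) 0) => [->|/fV[]]; first by rewrite mulr0.
    by rewrite inE xV (negbTE lV).
  have gS : supported i.+1 (stratum g V) (res (stratum g V) (on_faces w)).
    move=> s; rewrite /res; case: ifP => [sV nz|]; last by rewrite eqxx.
    by split=> //; apply/eqP; apply: contra_neqT nz => /eqP; apply: on_faces_out.
  exists (res (stratum g V) (on_faces w)) => // s sV.
  case: (eqVneq #|s| i) => [si|si].
    have [l ls] := face_onto si; rewrite -ls.
    move/rowP/(_ l): wE; rewrite taylor_tensor_mul mxE ls => ->.
    by move: sV; rewrite inE => /eqP ->.
  transitivity (0 : K).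
    by apply/eqP; apply: contraNT si => /(supported_bdry gS) ->.
  by apply/esym/eqP; apply: contraNT si => /fV[_ ->].
apply/graded_betti_eq0 => u uj u0.
have uS V : supported i (stratum g V) (res (stratum g V) (on_faces u)).
  move=> s; rewrite /res; case: ifP => [sV nz|]; last by rewrite eqxx.
  by split=> //; apply/eqP; apply: contra_neqT nz => /eqP; apply: on_faces_out.
(* The filling is taken to be zero when [V] has degree other than [j], so that the assembled vector
   lies in degree [j]. *)
have ex V : exists h, supported i.+1 (stratum g V) h /\ {in stratum g V, forall s,
    bdry h s = res (stratum g V) (on_faces u) s} /\ (mdeg V != j -> forall s, h s = 0).
  case: (eqVneq (mdeg V) j) => Vj.
    have [s sV|h hV hE] := aV V Vj _ (uS V); last by exists h.
    case: i u u0 uS {aV uj} => [|i] u /= u0 uS.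
      apply: big1 => x xs; case: (eqVneq (res (stratum g V) (on_faces u) (x |: s)) 0).
        by move=> ->; rewrite mulr0.
      by move=> /uS[_]; rewrite cardsU1 xs.
    case: (eqVneq #|s| i) => [si|si].
      have [l ls] := face_onto si; move/rowP/(_ l): u0; rewrite taylor_tensor_mul mxE ls.
      by move: sV; rewrite inE => /eqP ->.
    by apply/eqP; apply: contraNT si => /(supported_bdry (uS V)) ->.
  exists (fun=> 0); split=> [s|]; first by rewrite eqxx.
  split=> // s sV; transitivity (0 : K); first by apply: big1 => x _; rewrite mulr0.
  rewrite /res sV; apply/esym/eqP/negPn/negP => nz.
  case/negP: Vj; move: (sV); rewrite inE => /eqP <-.
  have si : #|s| = i by apply/eqP; apply: contra_neqT nz => /eqP; apply: on_faces_out.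
  have [k ks] := face_onto si; move: nz; rewrite -ks on_faceE => /uj <-.
  by [].
pose h V := sval (constructive_indefinite_description _ (ex V)).
have hP V := svalP (constructive_indefinite_description _ (ex V)).
rewrite -/(h _) in hP.
(* Each face takes its coefficient from the filling of its own stratum. *)
exists (\row_k h (lcms (face k)) (face k)).
  move=> k; rewrite mxE; case: (hP (lcms (face k))) => _ [_ h0].
  by apply: contra_neq_eq => kj; apply: h0.
have wE : on_faces (\row_(k < #|layer N i.+1|) h (lcms (face k)) (face k)) =1
    fun s => h (lcms s) s.
  by apply: on_faces_eq => [s|k]; [case: (hP (lcms s)) => + _ => /[apply] -[]|rewrite mxE].
apply/rowP => l; rewrite taylor_tensor_mul.
have [hS [hE _]] := hP (lcms (face l)).
have lin : face l \in stratum g (lcms (face l)) by rewrite inE.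
transitivity (bdry (h (lcms (face l))) (face l)).
  by rewrite hE // /res lin on_faceE.
apply: eq_bigr => x _; congr (_ * _); rewrite /res wE; case: ifPn => [|xl].
  by rewrite inE => /eqP ->.
by apply/eqP; apply: contraNT xl => /hS[].
Qed.

End Taylor.

(** * Maximal shifts *)

Section MinimalGenerators.

Variables (K : fieldType) (n : nat) (I : {mpoly K[n]} -> Prop).
Hypothesis hI : monomial_ideal I.

Lemma minimal_generator_below m : I 'X_[m] ->
  exists2 m', minimal_generator I m' & (m' <= m)%MM.
Proof.
have [k] := ubnP (mdeg m); elim: k m => // k IH m mk Im.
case: (classic (minimal_generator I m)) => [mm|nm]; first by exists m; rewrite ?lepm_refl.
have [m' [Im' m'm nm'm]] : exists m', [/\ I 'X_[m'], (m' <= m)%MM & m' <> m].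
  apply: NNPP => no; apply: nm; split=> // m' Im' m'm; apply: NNPP => ne.
  by apply: no; exists m'.
have [||q qm qm'] := IH m' => //.
  rewrite -ltnS; apply: leq_trans mk; rewrite ltnS ltn_neqAle lem_mdeg // andbT.
  by apply/eqP => E; apply/nm'm/lem_mdeg_eq.
by exists q => //; apply: lepm_trans m'm.
Qed.

(** The degree bound confines the generators to the finite type of multinomials of degree below
    [d.+1]. *)
Lemma finite_minimal_generators d :
    (forall m, minimal_generator I m -> (mdeg m <= d)%N) ->
  exists N (g : 'I_N -> 'X_{1..n}), injective g /\
    (forall m, minimal_generator I m <-> exists x, g x = m).
Proof.
move=> md.
have /fin_all_exists[b bE] (m : 'X_{1..n < d.+1}) :
    exists b : bool, b <-> minimal_generator I (val m).
  case: (classic (minimal_generator I (val m))) => mm; first by exists true.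
  by exists false.
pose s := [seq val m | m <- enum {: 'X_{1..n < d.+1}} & b m].
have s_uniq : uniq s by rewrite (map_inj_uniq val_inj) filter_uniq ?enum_uniq.
exists (size s), (tnth (in_tuple s)); split.
  by move=> x y; move/tuple_uniqP: (s_uniq : uniq (in_tuple s)); apply.
move=> m; split=> [mm|[x <-]].
  have /tnthP[x ->] : m \in in_tuple s; last by exists x.
  have md' : (mdeg m < d.+1)%N by rewrite ltnS md.
  apply/mapP; exists (BMultinom md') => //.
  by rewrite mem_filter mem_enum andbT; apply/bE.
have /mapP[q] := mem_tnth x (in_tuple s).
by rewrite mem_filter => /andP[/bE qm _] ->.
Qed.

Lemma monomial_ideal_generated N (g : 'I_N -> 'X_{1..n}) :
    (forall m, minimal_generator I m <-> exists x, g x = m) ->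
  forall f, I f <-> {in msupp f, forall m, exists x, (g x <= m)%MM}.
Proof.
move=> gE f; split=> [/(monomial_idealE hI) If m /If/minimal_generator_below[q /gE[x <-] xm]|If].
  by exists x.
apply/(monomial_idealE hI) => m /If[x xm].
rewrite -(submK xm) mpolyXD; apply: (monomial_idealM hI).
by have [] : minimal_generator I (g x) by apply/gE; exists x.
Qed.

End MinimalGenerators.

(** * Maximal shifts read off the homology of the strata *)

Section MaximalShifts.

Variables (K : fieldType) (n N : nat) (g : 'I_N -> 'X_{1..n}).
Variables (I : {mpoly K[n]} -> Prop) (F : graded_free_resolution I).
Hypothesis hI : monomial_ideal I.
Hypothesis gI : forall f, I f <-> {in msupp f, forall m, exists x, (g x <= m)%MM}.

Lemma graded_betti_stratum i j : graded_betti F i j <> 0%N <->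
  exists2 V, mdeg V = j & ~ acyc K i (stratum g V).
Proof.
have E : graded_betti F i j = 0%N <-> graded_betti (taylor_resolution gI) i j = 0%N.
  by split; apply: (graded_betti_eq0_trans hI).
rewrite E taylor_betti_eq0; split=> [nV|[V Vj nV] /(_ V Vj)//].
by apply: NNPP => no; apply: nV => V Vj; apply: NNPP => nV; apply: no; exists V.
Qed.

Lemma max_shift_ge i V : ~ acyc K i (stratum g V) -> (mdeg V <= max_shift F i)%N.
Proof.
by move=> nV; apply: max_shift_ub; apply/eqP/graded_betti_stratum; exists V.
Qed.

(** The first alternative covers the default value of an empty maximum, when all Betti numbers in
    homological degree [i] vanish. *)
Lemma max_shiftP i : max_shift F i = 0%N \/
  exists2 V, mdeg V = max_shift F i & ~ acyc K i (stratum g V).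
Proof.
case: (pickP (fun k => graded_betti F i (gfr_shift (g:=F) (i:=i) k) != 0%N)) => [k nz|no].
  by right; apply/graded_betti_stratum/eqP; apply: max_shift_attained nz.
by left; apply: big_pred0.
Qed.

Lemma max_shift0 : max_shift F 0 = 0%N.
Proof.
case: (max_shiftP 0) => // -[V <- /nacyc_card[s <- /cards0_eq ->]].
by rewrite lcms0 mdeg0.
Qed.

Lemma max_shift_le d i : (forall x, (mdeg (g x) <= d)%N) ->
  (max_shift F i <= d * i)%N.
Proof.
move=> gd; case: (max_shiftP i) => [-> //|[V <-]].
elim: i V => [|i IH] V; first by move=> /max_shift_ge; rewrite max_shift0 muln0.
by move=> /(nacyc_deg_step gd)[W /IH]; rewrite mulnS; lia.
Qed.

Variables (e d : nat).
Hypotheses (e_gt0 : (0 < e)%N) (g_deg : forall x, (e <= mdeg (g x) <= d)%N).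
Hypothesis g_anti : forall x y, (g x <= g y)%MM -> x = y.

(** When the shift is not the default 0, this reads delta_{a+k} >= delta_a + floor(k/2): each double
    step gains 1. *)
Lemma max_shift_growth a k : (max_shift F a < a * e)%N ->
    max_shift F (a + k) = 0%N \/
  (max_shift F (a + k) + k %/ 2 <= max_shift F a + d * k)%N.
Proof.
have gd x : (mdeg (g x) <= d)%N by case/andP: (g_deg x).
move=> ta; case: (max_shiftP (a + k)) => [|[V <- nV]]; [by left|right].
(* The recursion goes back two steps, so the induction carries [k] and [k.+1] together. *)
suff H : forall V, (~ acyc K (a + k) (stratum g V) ->
      (mdeg V + k %/ 2 <= max_shift F a + d * k)%N) /\
    (~ acyc K (a + k.+1) (stratum g V) ->
      (mdeg V + k.+1 %/ 2 <= max_shift F a + d * k.+1)%N) by case: (H V) => + _; apply.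
elim: k {V nV} => [|k IH] V.
  split; first by rewrite addn0 => /max_shift_ge; lia.
  by rewrite addn1 => /(nacyc_deg_step gd)[W /max_shift_ge]; lia.
split; first by case: (IH V).
(* The coprime alternative, taken at [a], gives a shift of at least [a * e] and contradicts [ta]. *)
rewrite !addnS => /(nacyc_deg_step2 e_gt0 g_deg g_anti)[/(_ a)[]|[W nW VW]].
- by rewrite -!addnS leq_addr.
- by move=> W /max_shift_ge; lia.
- have [/(_ nW) + _] := IH W; nia.
Qed.

End MaximalShifts.

Theorem corollary4p3 (K : fieldType) (n e d : nat)
    (he : (2 <= e)%N) (hed : (e <= d)%N)
    (I : {mpoly K[n]} -> Prop) (hI : monomial_ideal I)
    (hgen : forall m : 'X_{1..n},
       minimal_generator I m -> (e <= mdeg m <= d)%N)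
    (F : graded_free_resolution I)
    (p : nat) (hp : projective_dimension I p)
    (a : nat) (ha2 : (2 <= a)%N) (hap : (a <= p)%N)
    (hta : (max_shift F a < a * e)%N) :
  let t (i : nat) : int := (max_shift F i)%:Z in
  let delta (i : nat) : int := d%:Z * i%:Z - t i in
  (regularity F p <=
     Num.max ((d%:Z - 1) * (a%:Z - 1))
             ((d%:Z - 1) * p%:Z - delta a - ((p - a) %/ 2)%N%:Z))
  /\
  (regularity F p <=
     Num.max ((d%:Z - 1) * (a%:Z - 1))
             ((d%:Z - 1) * p%:Z - a%:Z * (d%:Z - e%:Z) - 1
                - ((p - a) %/ 2)%N%:Z)).
Proof.
move=> t delta.
have [N [g [g_inj gE]]] : exists N (g : 'I_N -> 'X_{1..n}), injective g /\
    (forall m, minimal_generator I m <-> exists x, g x = m).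
  by apply: (@finite_minimal_generators _ _ _ d) => m /hgen/andP[].
have g_min x : minimal_generator I (g x) by apply/gE; exists x.
have gI := monomial_ideal_generated hI gE.
have g_deg x : (e <= mdeg (g x) <= d)%N by apply: hgen.
have g_anti x y : (g x <= g y)%MM -> x = y.
  by move=> xy; apply: g_inj; apply: (g_min y).2 => //; case: (g_min x).
have e_gt0 : (0 < e)%N by lia.
set A := (d%:Z - 1) * (a%:Z - 1).
have A_ge0 : 0 <= A by apply: mulr_ge0; lia.
have reg_le B : (d%:Z - 1) * p%:Z - delta a - ((p - a) %/ 2)%N%:Z <= B ->
    regularity F p <= Num.max A B.
  move=> hB; rewrite /regularity; elim/big_ind: _ => [|x y xM yM|i _].
  - by rewrite (max_shift0 F hI gI) le_max A_ge0.
  - by rewrite ge_max xM yM.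
  rewrite le_max; apply/orP; move: (nat_of_ord i) (ltn_ord i) => {}i ip.
  (* Below [a] the estimate t_i <= d i gives t_i - i <= (d-1)(a-1); from [a] on, the growth estimate
     is used. *)
  case: (ltnP i a) => [ia|ai].
    left; have := @max_shift_le _ _ _ _ _ F hI gI d i (fun x => proj2 (andP (g_deg x))).
    rewrite /A; nia.
  have [z|tk] := @max_shift_growth _ _ _ _ _ F hI gI e d e_gt0 g_deg g_anti a (i - a) hta.
  (* A default shift 0 contributes only -i, which is below the nonnegative [A]. *)
  - by left; move: z; rewrite subnKC // => ->; lia.
  right; apply: le_trans hB; move: tk; rewrite subnKC // /delta /t.
  have -> : p = (a + (i - a) + (p - i))%N by lia.
  have -> : (i%:Z = a%:Z + (i - a)%N%:Z)%R by lia.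
  move: (i - a)%N (p - i)%N (max_shift F i) => k q ti.
  (* The bound at [i] is at most the bound at [p]: each of the [q] steps between them adds d-1 >= 1,
     while the subtracted floor grows by at most 1. *)
  have : (k %/ 2 + q <= (d - 1) * q + k %/ 2)%N by nia.
  nia.
split; apply: reg_le; first exact: lexx.
(* Since t_a <= ae - 1, delta_a is at least a(d-e) + 1. *)
rewrite /delta /t; nia.
Qed.
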